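(* Let $\gamma>0$ and let $X_1,X_2,\dots$ be i.i.d. nonnegative random variables with distribution function $F$ whose quantile function $U(t)=F^{\leftarrow}(1-1/t)$, $t\ge1$, satisfies $\lim_{t\to\infty}U(tx)/U(t)=x^{\gamma}$ for all $x>0$. Let $r\in\mathbb{R}$ with $\gamma r<1$, and let $k=k(n)$ be integers with $k(n)\to\infty$ and $n/k(n)\to\infty$. For $\ell=1,2,3$ let $$B_n^{(\ell)}(k,r)=\lim_{x\to\infty}\Big(\hat\gamma^{(\ell)}_n(k,r;X_1,\dots,X_{n-1},x)-\hat\gamma^{(\ell)}_{n-1}(k-1,r;X_1,\dots,X_{n-1})\Big),$$ and let $B^{(\ell)}=B^{(\ell)}(\gamma,r)$ denote the limit in probability of $B_n^{(\ell)}(k,r)$ as $n\to\infty$. Then for $j=1,2,3$, $$B^{(j)}=\begin{cases}0,& r<0,\\ \infty,& r=0,\\ (1-\gamma r)/r,& 0<r<1/\gamma.\end{cases}$$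
   Context: For a monotone function $W$, $W^{\leftarrow}(t)=\sup\{x: W(x)\le t\}$. For a sample $y_1,\dots,y_m$ with order statistics $y_{m,1}\le\dots\le y_{m,m}$ and $1\le k<m$, set $g_{r,u}(x)=x^r(\ln x)^u$ ($x\ge1$) and $G_m(k,r,u;y_1,\dots,y_m)=\frac1k\sum_{i=0}^{k-1}g_{r,u}(y_{m-i,m}/y_{m-k,m})$ (abbreviated $G$ below). The estimators evaluated on this sample are $$\hat\gamma^{(1)}_m(k,r;y_1,\dots,y_m)=\begin{cases}\dfrac{G_m(k,r,0)-1}{rG_m(k,r,0)},& r\ne0,\\ G_m(k,0,1),& r=0,\end{cases}\qquad \hat\gamma^{(2)}_m(k,r;y_1,\dots,y_m)=\frac{2G_m(k,r,1)}{2rG_m(k,r,1)+1+\sqrt{4rG_m(k,r,1)+1}},$$ $$\hat\gamma^{(3)}_m(k,r;y_1,\dots,y_m)=\begin{cases}\dfrac{rG_m(k,r,1)-G_m(k,r,0)+1}{r^2G_m(k,r,1)},& r\ne0,\\ \dfrac{G_m(k,0,2)}{2G_m(k,0,1)},& r=0.\end{cases}$$ *)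

(* Defs.v *)
From HB Require Import structures.
From mathcomp Require Import all_boot all_order all_algebra.
From mathcomp Require Import all_classical all_reals all_analysis.
Set Implicit Arguments. Unset Strict Implicit. Unset Printing Implicit Defensive.
Import Order.TTheory GRing.Theory Num.Theory.
Import numFieldNormedType.Exports.
Local Open Scope classical_set_scope.
Local Open Scope ring_scope.

Section Defs.
Variable R : realType.

(* order statistic y_{m,i} (1-indexed) of the sample s, m = size s *)
Definition ostat (s : seq R) (i : nat) : R := nth 0 (sort <=%R s) i.-1.

Definition gfun (r : R) (u : nat) (x : R) : R := x `^ r * (ln x) ^+ u.

Definition Gstat (k : nat) (r : R) (u : nat) (s : seq R) : R :=
  let m := size s in
  k%:R^-1 * \sum_(0 <= i < k) gfun r u (ostat s (m - i) / ostat s (m - k)).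

Definition gamma_hat1 (k : nat) (r : R) (s : seq R) : R :=
  if r == 0 then Gstat k 0 1 s
  else (Gstat k r 0 s - 1) / (r * Gstat k r 0 s).

Definition gamma_hat2 (k : nat) (r : R) (s : seq R) : R :=
  2 * Gstat k r 1 s /
  (2 * r * Gstat k r 1 s + 1 + Num.sqrt (4 * r * Gstat k r 1 s + 1)).

Definition gamma_hat3 (k : nat) (r : R) (s : seq R) : R :=
  if r == 0 then Gstat k 0 2 s / (2 * Gstat k 0 1 s)
  else (r * Gstat k r 1 s - Gstat k r 0 s + 1) / (r ^+ 2 * Gstat k r 1 s).

Definition gamma_hat (l : nat) : nat -> R -> seq R -> R :=
  match l with 1 => gamma_hat1 | 2 => gamma_hat2 | _ => gamma_hat3 end.

Definition ginv (W : R -> R) (t : R) : R := sup [set x | W x <= t].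

End Defs.

Section Prob.
Context d (T : measurableType d) (R : realType) (P : probability T R).

Definition mutually_independent (X : nat -> {RV P >-> R}) : Prop :=
  forall (s : seq nat) (B : nat -> set R), uniq s ->
    (forall i, measurable (B i)) ->
    P (\big[setI/setT]_(i <- s) (X i @^-1` B i)) =
    (\prod_(i <- s) P (X i @^-1` B i))%E.

Definition identically_distributed (X : nat -> {RV P >-> R}) : Prop :=
  forall i (A : set R), measurable A ->
    distribution P (X i) A = distribution P (X 0%N) A.

Definition distr_fun (Y : {RV P >-> R}) (x : R) : R := fine (cdf Y x).

Definition quantile_U (Y : {RV P >-> R}) (t : R) : R :=
  ginv (distr_fun Y) (1 - t^-1).

(* the sample X_1, ..., X_{m} (here indexed X 0, ..., X (m-1)) *)
Definition sample (X : nat -> {RV P >-> R}) (m : nat) (w : T) : seq R :=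
  [seq X i w | i <- iota 0 m].

Definition Bn (X : nat -> {RV P >-> R}) (l n k : nat) (r : R) (w : T) : \bar R :=
  lim ((fun x : R => (gamma_hat l k r (sample X n.-1 w ++ [:: x])
                      - gamma_hat l k.-1 r (sample X n.-1 w))%:E) @ +oo).

Definition cvg_in_prob (Y : nat -> T -> \bar R) (c : \bar R) : Prop :=
  match c with
  | EFin c => forall eps : R, 0 < eps ->
      (P [set w | (eps%:E <= `|Y n w - c%:E|)%E]) @[n --> \oo] --> 0%E
  | +oo%E => forall M : R,
      (P [set w | (Y n w <= M%:E)%E]) @[n --> \oo] --> 0%E
  | -oo%E => forall M : R,
      (P [set w | (M%:E <= Y n w)%E]) @[n --> \oo] --> 0%E
  end.

End Prob.

(* Main.v *)
(* Write m = n - 1 for the size of the sample before x is added, k for k(n) - 1,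
   Y for its threshold (the (k+1)-th largest value) and b = U(m / k).

   The number N(t) of observations above t is binomial, so Chebyshev's
   inequality and the regular variation of U give N(c b) / k -> c^(-1/gamma) in
   probability for each c > 0; in particular Y / b -> 1. Rounding the ratios
   y / Y to a geometric grid of ratio q > 1 turns G(k, r, 0) into the series
   1 + (1 - q^-r) sum_l q^(l r) N(q^l b) / k, up to a factor q^(2|r|). Its tail
   is controlled by Markov's inequality and a Potter-type bound because
   gamma r < 1; letting n -> oo and then q -> 1 yields
   G(k, r, 0) -> 1 / (1 - gamma r). As G(k, ., 0) is convex with derivative
   G(k, ., 1), also G(k, r, 1) -> gamma / (1 - gamma r)^2.

   A large additional observation x replaces k G by k G + g(x / Y), so B_n is
   1/r minus the estimator if r > 0, +oo if r = 0, and, if r < 0, the difference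
   of the estimator's formula at (k / (k+1)) G and at G.

   Probabilities are only meaningful on measurable sets, so B_n must be
   measurable; hence the limit over x is shown to exist, possibly infinite, at
   every sample point, including those where a denominator vanishes. *)
Require Import Defs.
From HB Require Import structures.
From mathcomp Require Import all_boot all_order all_algebra.
From mathcomp Require Import zify ring lra measurable_realfun.
From mathcomp Require Import all_classical all_reals all_analysis.
Import Order.TTheory GRing.Theory Num.Theory.
Import numFieldNormedType.Exports.
Local Open Scope classical_set_scope.
Local Open Scope ring_scope.
Set Implicit Arguments. Unset Strict Implicit. Unset Printing Implicit Defensive.

(** * The tail of a regularly varying quantile function *)

Lemma cvgr_le_ge (R : realType) (I : Type) (F : set_system I) {FF : Filter F}
    (f : I -> R) (l : R) :
  (forall a, a < l -> \forall x \near F, a <= f x) ->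
  (forall a, l < a -> \forall x \near F, f x <= a) ->
  f x @[x --> F] --> l.
Proof.
move=> lo hi; apply/cvgrPdist_le => e e0.
have /lo H1 : l - e < l by rewrite ltrBlDr ltrDl.
have /hi H2 : l < l + e by rewrite ltrDl.
apply: filterS2 H1 H2 => x H1 H2.
by rewrite ler_distlC H1 H2.
Qed.

Section tail.
Context d (T : measurableType d) (R : realType) (P : probability T R).
Variable Y : {RV P >-> R}.
Hypothesis Y0 : forall w, 0 <= Y w.

Definition tail_prob (x : R) : R := 1 - distr_fun Y x.

Lemma tail_probE x : P (Y @^-1` `]x, +oo[) = (tail_prob x)%:E.
Proof.
rewrite /tail_prob EFinB /distr_fun fineK ?fin_num_measure//.
exact: (ccdf_1_cdf Y x).
Qed.

Lemma tail_prob_ge0 x : 0 <= tail_prob x.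
Proof. by rewrite -lee_fin -tail_probE. Qed.

Lemma distr_fun_nd : {homo distr_fun Y : x y / x <= y}.
Proof.
move=> x y xy; rewrite /distr_fun fine_le ?fin_num_measure//.
exact: cdf_nondecreasing.
Qed.

Lemma distr_fun_neg x : x < 0 -> distr_fun Y x = 0.
Proof.
move=> x0; rewrite /distr_fun /cdf /distribution /pushforward.
rewrite (_ : _ @^-1` _ = set0) ?measure0//.
apply/seteqP; split=> // w /=; rewrite in_itv/= => /le_lt_trans/(_ x0).
by rewrite ltNge Y0.
Qed.

Lemma distr_fun_cvg1 : distr_fun Y x @[x --> +oo] --> (1 : R).
Proof.
have := cvg_cdfy1 Y; rewrite (_ : cdf Y = EFin \o distr_fun Y); last first.
  by apply/funext => x; rewrite /= /distr_fun fineK// fin_num_measure.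
by move/fine_cvg.
Qed.

Let U := quantile_U Y.

(** [sup] takes a default value on empty or unbounded sets, so [U] is the true quantile only if
    neither occurs. The set contains -1 because [Y] is nonnegative, and it is bounded because F
    tends to 1 while 1 - 1/t < 1. *)
Lemma quantile_has_sup t : 1 <= t ->
  has_sup [set x | distr_fun Y x <= 1 - t^-1].
Proof.
move=> t1; have t0 : 0 < t by exact: lt_le_trans t1.
split.
  by exists (-1); rewrite /= distr_fun_neg ?ltrN10// subr_ge0 invf_le1.
have [z Hz] : exists z, 1 - t^-1 < distr_fun Y z.
  have : \forall z \near +oo, 1 - t^-1 < distr_fun Y z.
    by apply: (cvgr_gt _ distr_fun_cvg1); rewrite ltrBlDr ltrDl invr_gt0.
  by move=> /filter_ex.
exists z => x /= Hx; rewrite leNgt; apply/negP => /ltW /distr_fun_nd.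
by move=> /(lt_le_trans Hz); rewrite ltNge Hx.
Qed.

(** With [gt_quantile_tail], this replaces inverting F, which may have jumps and flat parts: only
    points strictly on one side of U(t) are compared. *)
Lemma lt_quantile_tail t x : 1 <= t -> x < U t -> t^-1 <= tail_prob x.
Proof.
move=> t1; apply: contraPP; move/negP; rewrite -ltNge /tail_prob => H.
apply/negP; rewrite -leNgt; apply: ge_sup; first by case: (quantile_has_sup t1).
move=> z /= Hz; rewrite leNgt; apply/negP => /ltW /distr_fun_nd; lra.
Qed.

Lemma gt_quantile_tail t x : 1 <= t -> U t < x -> tail_prob x < t^-1.
Proof.
move=> t1; apply: contraPP; move/negP; rewrite -leNgt /tail_prob => H.
apply/negP; rewrite -leNgt; apply: ub_le_sup; first by case: (quantile_has_sup t1).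
by rewrite /=; lra.
Qed.

Lemma quantile_ge0 t : 1 <= t -> 0 <= U t.
Proof.
move=> t1; apply/ler_addgt0Pl => e e0.
rewrite -lerBlDl sub0r; apply: ub_le_sup; first by case: (quantile_has_sup t1).
by rewrite /= distr_fun_neg ?oppr_lt0// subr_ge0 invf_le1 ?(lt_le_trans _ t1).
Qed.

Variable gamma : R.
Hypothesis gamma0 : 0 < gamma.
Hypothesis RV : forall x : R, 0 < x -> (fun t => U (t * x) / U t) @ +oo --> x `^ gamma.

Lemma quantile_gt0 : \forall t \near +oo, 0 < U t.
Proof.
(* At x = 1 the ratio U(t)/U(t) tends to 1, whereas it would be 0 wherever U(t) = 0, since 0/0 =
   0. *)
have := RV ltr01; rewrite powR1 => /(cvgr_gt (1 : R)) /(_ 2^-1) H.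
have {}H : \forall t \near +oo, 2^-1 < U (t * 1) / U t by apply: H; lra.
near=> t; rewrite lt_neqAle quantile_ge0 ?andbT; last first.
  by near: t; apply: nbhs_pinfty_ge; rewrite num_real.
have : 2^-1 < U (t * 1) / U t by near: t; exact: H.
by case: eqP => // <-; rewrite invr0 mulr0 ltNge invr_ge0 ler0n.
Unshelve. all: by end_near. Qed.

(** Inversion of regular variation. If 0 < a < c^(-1/gamma), then c < (1/a)^gamma, so c U(t) <
    U(t/a) for large t and the tail at c U(t) is at least a/t. The upper bound is symmetric. *)
Lemma tail_quantile_cvg (c : R) : 0 < c ->
  t * tail_prob (c * U t) @[t --> +oo] --> c `^ (- gamma^-1).
Proof.
move=> c0; set v := c `^ _; have v0 : 0 < v by exact: powR_gt0.
have vc : v `^ (- gamma) = c.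
  by rewrite /v -powRrM mulrNN mulVf ?gt_eqF// powRr1 ?ltW.
apply: cvgr_le_ge => a av.
  have [a0|a0] := leP a 0.
    near=> t; apply: (le_trans a0); apply: mulr_ge0; last exact: tail_prob_ge0.
    by near: t; apply: nbhs_pinfty_ge; rewrite num_real.
  have ac : c < (a^-1) `^ gamma.
    rewrite -[a^-1]powR_inv1 ?ltW// -powRrM mulN1r -vc.
    rewrite !powRN ltf_pV2 ?posrE ?powR_gt0//.
    by rewrite gt0_ltr_powR// nnegrE ltW.
  have ia0 : 0 < a^-1 by rewrite invr_gt0.
  have := cvgr_gt _ (RV ia0) _ ac.
  move=> H; near=> t.
  have t0 : 0 < t by near: t; apply: nbhs_pinfty_gt; rewrite num_real.
  have Ut : 0 < U t by near: t; exact: quantile_gt0.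
  have : c * U t < U (t * a^-1) by rewrite -ltr_pdivlMr//; near: t; exact: H.
  have ta : 1 <= t * a^-1.
    by rewrite ler_pdivlMr// mul1r; near: t; apply: nbhs_pinfty_ge; rewrite num_real.
  move=> /(lt_quantile_tail ta); rewrite invfM invrK => h.
  by rewrite mulrC -ler_pdivrMr// mulrC.
have a0 : 0 < a := lt_trans v0 av.
have ac : (a^-1) `^ gamma < c.
  rewrite -[a^-1]powR_inv1 ?ltW// -powRrM mulN1r -vc.
  rewrite !powRN ltf_pV2 ?posrE ?powR_gt0//.
  by rewrite gt0_ltr_powR// nnegrE ltW.
have ia0 : 0 < a^-1 by rewrite invr_gt0.
have H := cvgr_lt _ (RV ia0) _ ac.
near=> t.
have t0 : 0 < t by near: t; apply: nbhs_pinfty_gt; rewrite num_real.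
have Ut : 0 < U t by near: t; exact: quantile_gt0.
have : U (t * a^-1) < c * U t by rewrite -ltr_pdivrMr//; near: t; exact: H.
have ta : 1 <= t * a^-1.
  by rewrite ler_pdivlMr// mul1r; near: t; apply: nbhs_pinfty_ge; rewrite num_real.
move=> /(gt_quantile_tail ta); rewrite invfM invrK => /ltW h.
by rewrite -ler_pdivlMl.
Unshelve. all: by end_near. Qed.

(* A Potter-type bound obtained by iterating U(lambda t) < q U(t), with
   lambda = q^s. *)
Lemma tail_quantile_bound (q s : R) : 1 < q -> 0 <= s -> s * gamma < 1 ->
  \forall t \near +oo, forall l, (0 < l)%N ->
    t * tail_prob (q ^+ l * U t) <= (q `^ (- s)) ^+ l.
Proof.
move=> q1 s0 sg; have q0 : 0 < q by exact: lt_trans q1.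
pose lam := q `^ s; have lam0 : 0 < lam by exact: powR_gt0.
have lam1 : 1 <= lam by rewrite /lam -[leLHS](powRr0 q) ler_powR// ltW.
have lamq : lam `^ gamma < q.
  by rewrite /lam -powRrM -[ltRHS]powRr1 ?ltW// /powR gt_eqF// ltr_expR ltr_pM2r// ln_gt0.
(* An explicit bound [M] is extracted because the inequality is applied at all points t lam^n, which
   stay beyond [M] as lam >= 1. *)
have [M [_ HM]] : \forall t \near +oo, 0 < U t /\ U (t * lam) < q * U t /\ 1 <= t.
  have H := cvgr_lt _ (RV lam0) _ lamq.
  near=> t; have Ut : 0 < U t by near: t; exact: quantile_gt0.
  split=> //; split.
    by rewrite -ltr_pdivrMr//; near: t; exact: H.
  by near: t; apply: nbhs_pinfty_ge; rewrite num_real.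
near=> t => l l0.
have Mt : M < t by near: t; apply: nbhs_pinfty_gt; rewrite num_real.
have [Ut [_ t1]] := HM _ Mt.
have t0 : 0 < t by exact: lt_le_trans t1.
have lamn n : 1 <= lam ^+ n by rewrite exprn_ege1.
have tlam n : t <= t * lam ^+ n by rewrite ler_peMr// ltW.
have Ul n : U (t * lam ^+ n) <= q ^+ n * U t /\ U (t * lam ^+ n.+1) < q ^+ n.+1 * U t.
  elim: n => [|n [_ IH]].
    by rewrite expr0 !mulr1 mul1r lexx; split=> //; rewrite !expr1; case: (HM _ Mt) => _ [].
  split; first exact: ltW.
  have [_ [h _]] := HM _ (lt_le_trans Mt (tlam n.+1)).
  rewrite [in X in U X < _]exprSr mulrA (lt_trans h)// [in ltRHS]exprS -mulrA.
  by rewrite ltr_pM2l.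
case: l l0 => // l _; have [_ /gt_quantile_tail] := Ul l.
have -> : (q `^ (- s)) ^+ l.+1 = (lam ^+ l.+1)^-1 by rewrite powRN exprVn.
rewrite invfM => /(_ (le_trans t1 (tlam _))) /ltW h.
by rewrite -ler_pdivlMl.
Unshelve. all: by end_near. Qed.

End tail.

(** * Chebyshev bounds for counts, and convergence in probability *)

Section markov_chebyshev.
Context d (T : measurableType d) (R : realType) (P : probability T R).
Local Open Scope ereal_scope.

Lemma measurable_ge (f : T -> R) (c : R) :
  measurable_fun setT f -> measurable [set w | c <= f w]%R.
Proof.
move=> mf; rewrite -[X in measurable X]setTI.
have -> : [set w | c <= f w]%R = f @^-1` `[c, +oo[.
  by apply/seteqP; split=> w /=; rewrite in_itv/= andbT.
by apply: mf => //; exact: measurable_itv.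
Qed.

Lemma markov_ge0 (f : T -> R) (c : R) : measurable_fun setT f ->
  (forall w, 0 <= f w)%R -> (0 < c)%R ->
  P [set w | c <= f w]%R <= c^-1%:E * \int[P]_w (f w)%:E.
Proof.
move=> mf f0 c0.
have mEf : measurable_fun setT (EFin \o f) by exact/measurable_EFinP.
have := @le_integral_comp_abse _ _ _ P setT measurableT (EFin \o f) c id
  (@measurable_id _ _ setT) (fun r h => h) _ mEf c0.
rewrite setTI => H.
have {}H : c%:E * P [set x | c%:E <= `|(EFin \o f) x|] <=
           \int[P]_x `|(EFin \o f) x| by apply: H => x y _ _.
have E : [set x | c%:E <= `|(EFin \o f) x|] = [set w | c <= f w]%R.
  by apply/seteqP; split=> w /=; rewrite lee_fin ger0_norm.
have E2 : \int[P]_x `|(EFin \o f) x| = \int[P]_w (f w)%:E.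
  by apply: eq_integral => x _ /=; rewrite ger0_norm.
rewrite -E lee_pdivlMl//; rewrite E2 in H; exact: H.
Qed.

Variables (A : nat -> set T) (p : R).
Hypothesis mA : forall i, measurable (A i).
Hypothesis PA : forall i, P (A i) = p%:E.
Hypothesis PAA : forall i j, i != j -> P (A i `&` A j) = (p * p)%:E.

Lemma int_indicT (B : set T) : measurable B -> \int[P]_w (\1_B w)%:E = P B.
Proof. by move=> mB; rewrite integral_indic// setIT. Qed.

Definition count_ev (m : nat) (w : T) : R := (\sum_(0 <= i < m) \1_(A i) w)%R.

Lemma count_ev_ge0 m w : (0 <= count_ev m w)%R.
Proof. by apply: sumr_ge0 => i _. Qed.

Lemma measurable_count_ev m : measurable_fun setT (count_ev m).
Proof. by apply: measurable_sum => i; exact: measurable_indic. Qed.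

Lemma prob_ev_ge0 : (0 <= p)%R.
Proof. by rewrite -lee_fin -(PA 0). Qed.

Lemma int_count_ev m : \int[P]_w (count_ev m w)%:E = (m%:R * p)%:E.
Proof.
under eq_integral do rewrite -sumEFin.
rewrite ge0_integral_sum//; last first.
  by move=> i; apply/measurable_EFinP; exact: measurable_indic.
under eq_bigr do rewrite int_indicT// PA.
by rewrite sumEFin sumr_const_nat subn0 mulr_natl.
Qed.

(** The square is a double sum of indicators of [A i] and [A j] together: off-diagonal terms give
    p^2, diagonal ones p, bounded by p + p^2 to make the sum uniform. Only pairwise independence
    enters. *)
Lemma int_count_ev_sqr m :
  \int[P]_w (count_ev m w ^+ 2)%:E <= (m%:R * p + (m%:R * p) ^+ 2)%:E.
Proof.
have E w : (count_ev m w ^+ 2)%:E =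
    \sum_(0 <= i < m) \sum_(0 <= j < m) (\1_(A i `&` A j) w)%:E.
  rewrite expr2 /count_ev mulr_suml -sumEFin; apply: eq_bigr => i _.
  rewrite mulr_sumr -sumEFin; apply: eq_bigr => j _.
  by rewrite indicI.
have mI i j : measurable_fun setT (fun w => (\1_(A i `&` A j) w)%:E : \bar R).
  by apply/measurable_EFinP; apply: measurable_indic; exact: measurableI.
under eq_integral do rewrite E.
rewrite ge0_integral_sum//; last 2 first.
- by move=> i; apply: emeasurable_sum => j.
- by move=> i w _; apply: sume_ge0 => j _; rewrite lee_fin.
have -> : (m%:R * p + (m%:R * p) ^+ 2 =
  \sum_(0 <= i < m) \sum_(0 <= j < m) ((i == j)%:R * p + p * p))%R.
  under eq_big_nat => i /andP[_ im].
    rewrite big_split/= -mulr_suml sumr_const_nat subn0.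
    rewrite (bigD1_seq i)/= ?mem_index_iota ?iota_uniq// eqxx big1 ?addr0 ?mul1r.
      over.
    by move=> j; rewrite eq_sym => /negPf ->.
  by rewrite sumr_const_nat subn0; ring.
rewrite -sumEFin; apply: lee_sum => i _.
rewrite ge0_integral_sum// -sumEFin; apply: lee_sum => j _.
rewrite int_indicT; last exact: measurableI.
have [->|ij] := eqVneq i j.
  by rewrite setIid PA mul1r lee_fin lerDl mulr_ge0// prob_ev_ge0.
by rewrite PAA// mul0r add0r.
Qed.

Lemma variance_count_ev m :
  \int[P]_w ((count_ev m w - m%:R * p) ^+ 2)%:E <= (m%:R * p)%:E.
Proof.
set mu := (m%:R * p)%R.
have mu0 : (0 <= mu)%R by rewrite mulr_ge0// prob_ev_ge0.
have mN := measurable_count_ev m.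
have mD : measurable_fun setT (fun w => ((count_ev m w - mu) ^+ 2)%:E).
  by apply/measurable_EFinP; apply: measurable_funX; exact: measurable_funB.
(* The expansion of (N - mu)^2 is arranged without subtraction, so that every integrand is
   nonnegative; the finite term 2 mu^2 is cancelled at the end. *)
have H : \int[P]_w (((count_ev m w - mu) ^+ 2)%:E + (2 * mu)%:E * (count_ev m w)%:E) =
         \int[P]_w ((count_ev m w ^+ 2)%:E + (mu ^+ 2)%:E).
  by apply: eq_integral => w _; rewrite -EFinM -!EFinD; congr EFin; ring.
move: H; rewrite ge0_integralD//; last 3 first.
- by move=> w _; rewrite lee_fin sqr_ge0.
- move=> w _; rewrite -EFinM lee_fin; apply: mulr_ge0; last exact: count_ev_ge0.
  by rewrite mulr_ge0.
- by apply/measurable_EFinP; exact: measurable_funM.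
rewrite ge0_integralZl_EFin//; last 3 first.
- by move=> w _; rewrite lee_fin count_ev_ge0.
- exact/measurable_EFinP.
- by rewrite mulr_ge0.
rewrite ge0_integralD//; last 3 first.
- by move=> w _; rewrite lee_fin sqr_ge0.
- by apply/measurable_EFinP; exact: measurable_funX.
- by move=> w _; rewrite lee_fin sqr_ge0.
rewrite int_count_ev.
have -> : \int[P]__ (mu ^+ 2)%:E = (mu ^+ 2)%:E.
  by rewrite integral_cst// -[RHS]mule1; congr (_ * _); exact: probability_setT.
move=> H.
rewrite -(@leeD2rE _ ((2 * mu)%:E * mu%:E))// H.
apply: (le_trans (leeD2r _ (int_count_ev_sqr m))).
by rewrite -EFinM -!EFinD lee_fin /mu; nra.
Qed.

Lemma count_ev_chebyshev m (c : R) : (0 < c)%R ->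
  P [set w | c <= `|count_ev m w - m%:R * p|]%R <= (m%:R * p / c ^+ 2)%:E.
Proof.
move=> c0.
have -> : [set w | c <= `|count_ev m w - m%:R * p|]%R =
          [set w | c ^+ 2 <= (count_ev m w - m%:R * p) ^+ 2]%R.
  apply/seteqP; split=> w /=; rewrite -[((count_ev m w - _) ^+ 2)%R]real_normK ?num_real//.
    by move=> h; rewrite lerXn2r// nnegrE ltW.
  by rewrite ler_pXn2r// nnegrE ltW.
apply: (le_trans (markov_ge0 _ _ _)) => /=.
- by apply: measurable_funX; apply: measurable_funB => //; exact: measurable_count_ev.
- by move=> w; rewrite sqr_ge0.
- by rewrite exprn_gt0.
- rewrite [(m%:R * p / c ^+ 2)%R]mulrC EFinM; apply: lee_wpmul2l; last exact: variance_count_ev.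
  by rewrite lee_fin invr_ge0 exprn_ge0// ltW.
Qed.

Lemma count_ev_markov m (c : R) : (0 < c)%R ->
  P [set w | c <= count_ev m w]%R <= (m%:R * p / c)%:E.
Proof.
move=> c0; apply: (le_trans (markov_ge0 _ _ _)) => //.
- exact: measurable_count_ev.
- exact: count_ev_ge0.
- by rewrite int_count_ev -EFinM mulrC.
Qed.

End markov_chebyshev.

(* Neighbourhoods of infinity with high probability: a property of (n, w)
   holds near [whp P] when, up to probability e, it holds for all large n;
   thus convergence along this filter is convergence in probability. *)
Section whp.
Context d (T : measurableType d) (R : realType) (P : probability T R).

Definition whp : set_system (nat * T) := fun S =>
  forall e : R, 0 < e -> \forall n \near \oo, exists A : set T,
    [/\ measurable A, (forall w, A w -> S (n, w)) & (P (~` A) <= e%:E)%E].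

Global Instance whp_filter : Filter whp.
Proof.
split.
- move=> e e0; near=> n; exists setT; split=> //.
  by rewrite setCT measure0 lee_fin ltW.
- move=> S1 S2 H1 H2 e e0.
  have e20 : 0 < e / 2 by rewrite divr_gt0.
  near=> n.
  have [A1 [mA1 S1A PA1]] : exists A : set T,
    [/\ measurable A, (forall w, A w -> S1 (n, w)) & (P (~` A) <= (e / 2)%:E)%E].
    by near: n; exact: H1.
  have [A2 [mA2 S2A PA2]] : exists A : set T,
    [/\ measurable A, (forall w, A w -> S2 (n, w)) & (P (~` A) <= (e / 2)%:E)%E].
    by near: n; exact: H2.
  exists (A1 `&` A2); split.
  + exact: measurableI.
  + by move=> w [/S1A ? /S2A].
  + rewrite setCI (le_trans (measureU2 _ _ _))//; try exact: measurableC.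
    by rewrite (splitr e) EFinD leeD.
- move=> S1 S2 S12 H1 e e0; near=> n.
  have [A [mA SA PA]] : exists A : set T,
    [/\ measurable A, (forall w, A w -> S1 (n, w)) & (P (~` A) <= e%:E)%E].
    by near: n; exact: H1.
  by exists A; split=> // w /SA /S12.
Unshelve. all: by end_near. Qed.

Lemma whp_near (Q : nat -> Prop) :
  (\forall n \near \oo, Q n) -> \forall x \near whp, Q x.1.
Proof.
move=> HQ e e0; near=> n; exists setT; split=> //.
  by move=> w _ /=; near: n.
by rewrite setCT measure0 lee_fin ltW.
Unshelve. all: by end_near. Qed.

Lemma cvg_whp_fst (u : nat -> R) (l : R) :
  u n @[n --> \oo] --> l -> u x.1 @[x --> whp] --> l.
Proof. by move=> ul S /ul /whp_near. Qed.

(** The way back from [whp] to probabilities: [S n] lies in the complement of an event of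
    probability close to 1, and monotonicity of [P] applies as [S n] is measurable. *)
Lemma whp_prob0 (S : nat -> set T) :
  (\forall n \near \oo, measurable (S n)) ->
  (\forall x \near whp, ~ S x.1 x.2) ->
  P (S n) @[n --> \oo] --> 0%E.
Proof.
move=> mS HS.
have fin : \forall n \near \oo, P (S n) \is a fin_num.
  by near=> n; rewrite fin_num_measure//; near: n.
apply/fine_cvgP; split=> //; apply/cvgrPdist_le => e e0.
near=> n.
have [A [mA SA PA]] : exists A : set T,
    [/\ measurable A, (forall w, A w -> ~ S n w) & (P (~` A) <= e%:E)%E].
  by near: n; exact: HS.
have mSn : measurable (S n) by near: n.
rewrite sub0r normrN ger0_norm ?fine_ge0//.
rewrite -lee_fin fineK ?fin_num_measure//.
apply: (le_trans _ PA); apply: le_measure; rewrite ?inE//; first exact: measurableC.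
by move=> w Sw /SA.
Unshelve. all: by end_near. Qed.

End whp.

(** * Numbers of exceedances *)

Definition exceed (R : realType) (x : R) (s : seq R) : nat := count (fun y => x < y) s.

Lemma nneseries_geometric (R : realType) (a z : R) : `|z| < 1 ->
  (\sum_(0 <= i <oo) (a * z ^+ i)%:E = (a / (1 - z))%:E)%E.
Proof.
move=> z1; transitivity (limn (EFin \o series (geometric a z))).
  by congr (limn _); apply/funext => n /=; rewrite sumEFin.
rewrite EFin_lim; last exact: is_cvg_geometric_series.
by congr EFin; apply/cvg_lim => //; exact: cvg_geometric_series.
Qed.

Section exceed.
Context d (T : measurableType d) (R : realType) (P : probability T R).
Variable X : nat -> {RV P >-> R}.
Hypothesis X_indep : mutually_independent X.
Hypothesis X_id : identically_distributed X.
Hypothesis X_ge0 : forall i w, 0 <= X i w.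

Let above x i := X i @^-1` `]x, +oo[.

Lemma exceed_sample m x w :
  (exceed x (sample X m w))%:R = count_ev R (above x) m w.
Proof.
rewrite /exceed count_map -sum1_count big_mkcond natr_sum /count_ev /index_iota subn0.
apply: eq_bigr => i _; rewrite indicE /=; case: ifPn => xi.
  by rewrite mem_set//= /above /= in_itv/= xi.
by rewrite memNset//= /above /= in_itv/= andbT; exact/negP.
Qed.

Lemma measurable_above x i : measurable (above x i).
Proof. by rewrite -[above x i]setTI; apply: measurable_funP. Qed.

Lemma prob_above x i : P (above x i) = (tail_prob (X 0%N) x)%:E.
Proof. by rewrite -tail_probE; exact: (X_id i (measurable_itv _)). Qed.

Lemma prob_aboveI x i j : i != j ->
  P (above x i `&` above x j) = (tail_prob (X 0%N) x * tail_prob (X 0%N) x)%:E.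
Proof.
move=> ij.
have := @X_indep [:: i; j] (fun=> `]x, +oo[%classic).
rewrite !big_cons !big_nil setIT mule1 EFinM => -> //.
- by congr (_ * _)%E; [exact: (prob_above x i)|exact: (prob_above x j)].
- by rewrite /= inE ij.
Qed.

Variable gamma : R.
Hypothesis gamma0 : 0 < gamma.
Let U := quantile_U (X 0%N).
Hypothesis RV : forall x : R, 0 < x -> (fun t => U (t * x) / U t) @ +oo --> x `^ gamma.

Variables m k : nat -> nat.
Hypothesis k_oo : (k n)%:R @[n --> \oo] --> (+oo : set_system R).
Hypothesis mk_oo : (m n)%:R / (k n)%:R @[n --> \oo] --> (+oo : set_system R).
Let b n := U ((m n)%:R / (k n)%:R).

Lemma k_gt0 : \forall n \near \oo, 0 < (k n)%:R :> R.
Proof. by have /cvgryPgt/(_ 0) := k_oo. Qed.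

Lemma b_gt0 : \forall n \near \oo, 0 < b n.
Proof. exact: (mk_oo (quantile_gt0 (X_ge0 0%N) RV)). Qed.

(** With t = m/k, the mean of the normalised count is t times the tail at c U(t), whose limit is
    given by [tail_quantile_cvg]. Its variance is at most this mean divided by k, hence tends to
    0. *)
Lemma exceed_cvg c : 0 < c ->
  (exceed (c * b x.1) (sample X (m x.1) x.2))%:R / (k x.1)%:R @[x --> whp P]
    --> c `^ (- gamma^-1).
Proof.
move=> c0; set v := c `^ _.
pose tn n : R := (m n)%:R / (k n)%:R.
pose a n := tn n * tail_prob (X 0%N) (c * U (tn n)).
have av : a n @[n --> \oo] --> v.
  exact: (cvg_comp _ _ mk_oo (tail_quantile_cvg (X_ge0 0%N) gamma0 RV c0)).
apply/cvgrPdist_le => e e0 e1 e10.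
have e20 : 0 < e / 2 by rewrite divr_gt0.
have ak : a n * (k n)%:R^-1 @[n --> \oo] --> (0 : R).
  rewrite -[X in _ --> X](mulr0 v); apply: cvgM => //.
  by apply/gtr0_cvgV0 => //; exact: k_gt0.
near=> n.
have kn0 : 0 < (k n)%:R :> R by near: n; exact: k_gt0.
pose p := tail_prob (X 0%N) (c * b n).
exists (~` [set w | e / 2 * (k n)%:R <= `|count_ev R (above (c * b n)) (m n) w - (m n)%:R * p|]).
have mE : measurable [set w | e / 2 * (k n)%:R <= `|count_ev R (above (c * b n)) (m n) w - (m n)%:R * p|].
  apply: measurable_ge; apply: measurableT_comp => //.
  by apply: measurable_funB => //; apply: measurable_count_ev => i; exact: measurable_above.
split.
- exact: measurableC.
- move=> w /= /negP; rewrite -ltNge exceed_sample => h.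
  rewrite [leRHS]splitr (le_trans (ler_distD (a n) _ _))// lerD//.
    by near: n; apply: cvgr_dist_le.
  have -> : a n - count_ev R (above (c * b n)) (m n) w / (k n)%:R =
    - (count_ev R (above (c * b n)) (m n) w - (m n)%:R * p) / (k n)%:R.
    by rewrite /a /p /tn /b; field; rewrite gt_eqF.
  rewrite mulNr normrN normrM [X in _ * X]ger0_norm ?invr_ge0 ?ltW//.
  by rewrite ltr_pdivrMr.
- rewrite setCK.
  have := @count_ev_chebyshev _ _ _ P (above (c * b n)) p (measurable_above _)
    (prob_above _) (prob_aboveI _) (m n) _ (mulr_gt0 e20 kn0).
  move=> /le_trans; apply; rewrite lee_fin.
  have -> : (m n)%:R * p / (e / 2 * (k n)%:R) ^+ 2 = (a n * (k n)%:R^-1) / (e / 2) ^+ 2.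
    by rewrite /a /p /tn /b; field; rewrite !gt_eqF.
  rewrite ler_pdivrMr ?exprn_gt0//.
  near: n; apply: (cvgr_le _ ak).
  by rewrite mulr_gt0// exprn_gt0.
Unshelve. all: by end_near. Qed.

(** Union bound over all levels l >= L. By Markov's inequality and the Potter-type bound, level l
    fails with probability at most rho^l, where rho = q^(-s) / theta < 1; the sum rho^L / (1 - rho)
    is small for large L, uniformly in n. *)
Lemma exceed_tail (q s theta : R) : 1 < q -> 0 <= s -> s * gamma < 1 ->
  q `^ (- s) < theta -> forall e, 0 < e -> exists L0, forall L, (L0 <= L)%N ->
  \forall n \near \oo, exists A : set T, [/\ measurable A,
    (forall w, A w -> forall l, (L <= l)%N ->
       (exceed (q ^+ l * b n) (sample X (m n) w))%:R <= (k n)%:R * theta ^+ l)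
    & (P (~` A) <= e%:E)%E].
Proof.
move=> q1 s0 sg qt e e0.
have qs0 : 0 < q `^ (- s) by rewrite powR_gt0// (lt_trans _ q1).
have t0 : 0 < theta by exact: lt_trans qt.
pose rho := q `^ (- s) / theta.
have rho0 : 0 < rho by rewrite divr_gt0.
have rho1 : rho < 1 by rewrite ltr_pdivrMr// mul1r.
have nrho : `|rho| < 1 by rewrite ger0_norm// ltW.
have [L0 _ HL0] : \forall L \near \oo, rho ^+ L / (1 - rho) <= e.
  have := cvg_geometric (1 - rho)^-1 nrho.
  by move=> /(cvgr_le (0 : R))/(_ _ e0); apply: filterS => L; rewrite /geometric/= mulrC.
(* The successor keeps every level l >= L positive, as [tail_quantile_bound] requires. *)
exists L0.+1 => L L0L.
have Hb : \forall n \near \oo, forall l, (0 < l)%N ->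
    (m n)%:R / (k n)%:R * tail_prob (X 0%N) (q ^+ l * b n) <= q `^ (- s) ^+ l.
  exact: (mk_oo (tail_quantile_bound (X_ge0 0%N) RV q1 s0 sg)).
near=> n.
have kn0 : 0 < (k n)%:R :> R by near: n; exact: k_gt0.
pose N l w := count_ev R (above (q ^+ l * b n)) (m n) w.
pose F l := [set w | (k n)%:R * theta ^+ (L + l) <= N (L + l)%N w].
have mF l : measurable (F l).
  by apply: measurable_ge; apply: measurable_count_ev => i; exact: measurable_above.
exists (~` \bigcup_l F l); split.
- by apply: measurableC; exact: bigcup_measurable.
- move=> w; rewrite setC_bigcup => Aw l Ll; rewrite exceed_sample leNgt; apply/negP => h.
  apply: (Aw (l - L)%N I); rewrite /F /= subnKC//; exact: ltW.
- rewrite setCK.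
  have := @measure_sigma_subadditive _ _ _ P (\bigcup_l F l) F mF
    (bigcup_measurable (fun l _ => mF l)) (@subset_refl _ _).
  move=> /le_trans; apply.
  apply: (@le_trans _ _ (\sum_(0 <= l <oo) (rho ^+ L * rho ^+ l)%:E)%E).
    apply: lee_nneseries => // l _.
    have /= := @count_ev_markov _ _ _ P (above (q ^+ (L + l) * b n)) _ (measurable_above _)
      (prob_above _) (m n) ((k n)%:R * theta ^+ (L + l)) _.
    move=> /(_ (mulr_gt0 kn0 (exprn_gt0 _ t0))) /le_trans; apply.
    rewrite lee_fin -exprD /rho expr_div_n.
    rewrite invfM mulrA ler_pM2r ?invr_gt0 ?exprn_gt0//.
    rewrite mulrAC.
    suff /(_ (L + l)%N) : forall l, (0 < l)%N ->
        (m n)%:R / (k n)%:R * tail_prob (X 0%N) (q ^+ l * b n) <= q `^ (- s) ^+ l.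
      by apply; rewrite addn_gt0 (leq_ltn_trans _ L0L).
    by near: n; exact: Hb.
  rewrite nneseries_geometric// lee_fin.
  by apply: HL0; rewrite /= ltnW.
Unshelve. all: by end_near. Qed.

End exceed.

(** * Order statistics and geometric levels *)

Section order_statistics.
Variable R : realType.
Implicit Types (s : seq R) (x y : R).

Definition top (k : nat) s : seq R := drop (size s - k) (sort <=%R s).

Lemma sort_nth_homo s i j : (i <= j)%N -> (j < size s)%N ->
  nth 0 (sort <=%R s) i <= nth 0 (sort <=%R s) j.
Proof.
move=> ij js; apply: le_sorted_leq_nth => //; rewrite ?inE ?size_sort//.
  exact: sort_le_sorted.
exact: leq_ltn_trans js.
Qed.

Lemma size_top k s : (k <= size s)%N -> size (top k s) = k.
Proof. by move=> ks; rewrite size_drop size_sort subKn. Qed.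

Lemma sum_ostat_top k s (f : R -> R) : (k <= size s)%N ->
  \sum_(0 <= i < k) f (ostat s (size s - i)) = \sum_(y <- top k s) f y.
Proof.
move=> ks; rewrite [RHS](big_nth 0) size_top// big_nat_rev/= add0n.
apply: eq_big_nat => i /andP[_ ik]; rewrite /top nth_drop /ostat; congr (f (nth _ _ _)).
lia.
Qed.

Lemma top_ge k s y : (k < size s)%N -> y \in top k s -> ostat s (size s - k) <= y.
Proof.
move=> ks /(nthP 0)[i]; rewrite size_top ?(ltnW ks)// => ik <-.
by rewrite nth_drop /ostat; apply: sort_nth_homo; lia.
Qed.

Lemma bottom_le k s y : (k < size s)%N -> y \in take (size s - k) (sort <=%R s) ->
  y <= ostat s (size s - k).
Proof.
move=> ks /(nthP 0)[i]; rewrite size_take size_sort => ik <-.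
have {}ik : (i < size s - k)%N by move: ik; case: ifP => //; lia.
by rewrite nth_take// /ostat; apply: sort_nth_homo; lia.
Qed.

Lemma exceed_top k s x : (k < size s)%N -> ostat s (size s - k) <= x ->
  exceed x s = count (fun y => x < y) (top k s).
Proof.
move=> ks Yx; rewrite /exceed -(permP (permEl (perm_sort <=%R s))).
rewrite -[in LHS](cat_take_drop (size s - k) (sort <=%R s)) count_cat.
rewrite (@eq_in_count _ _ pred0 (take _ _)) ?count_pred0// => y /bottom_le -/(_ ks) yY.
by apply/negP/negP; rewrite -leNgt (le_trans yY).
Qed.

(** With [ostat_le], this is the duality between thresholds and counts. It serves both to locate the
    threshold and to prove order statistics measurable. *)
Lemma ostat_gt k s x : (k < size s)%N -> (k < exceed x s)%N -> x < ostat s (size s - k).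
Proof.
move=> ks ke; rewrite ltNge; apply/negP => /(exceed_top ks) E.
by move: ke; rewrite E ltnNge -{2}(size_top (ltnW ks)) count_size.
Qed.

Lemma ostat_le k s x : (k < size s)%N -> (exceed x s <= k)%N -> ostat s (size s - k) <= x.
Proof.
move=> ks; apply: contraTT; rewrite -ltNge -ltnNge => xY.
rewrite /exceed -(permP (permEl (perm_sort <=%R s))).
rewrite -(cat_take_drop (size s - k).-1 (sort <=%R s)) count_cat.
(* One more value than [top] is kept: the threshold and the k values after it are k + 1 values above
   x. *)
apply: (@leq_trans (count (fun y => x < y) (drop (size s - k).-1 (sort <=%R s)))).
  suff /eqP -> : count (fun y => x < y) (drop (size s - k).-1 (sort <=%R s)) ==
      size (drop (size s - k).-1 (sort <=%R s)).
    have aux m : (k < m)%N -> (k < m - (m - k).-1)%N by lia.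
    by rewrite size_drop size_sort; exact: aux.
  rewrite -all_count; apply/allP => y /(nthP 0)[i]; rewrite size_drop size_sort => ik <-.
  rewrite nth_drop; apply/(lt_le_trans xY); apply: sort_nth_homo.
    exact: leq_addr.
  by rewrite -ltn_subRL.
exact: leq_addl.
Qed.

Lemma ostat_ge0 s i : (forall y, y \in s -> 0 <= y) -> 0 <= ostat s i.
Proof.
move=> s0; rewrite /ostat; have [h|h] := ltnP i.-1 (size s).
  by apply: s0; rewrite -(mem_sort <=%R); apply: mem_nth; rewrite size_sort.
by rewrite nth_default// size_sort.
Qed.

Lemma GstatE k r u s : (k <= size s)%N ->
  Gstat k r u s = k%:R^-1 * \sum_(y <- top k s) gfun r u (y / ostat s (size s - k)).
Proof. by move=> ks; rewrite /Gstat (@sum_ostat_top k s (fun y => gfun r u (y / _))). Qed.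

End order_statistics.

(** * Rounding the observations to a geometric grid *)

Section levels.
Variable R : realType.

Lemma powR_btw (q z r : R) : 1 < q -> q ^- 2 <= z <= q ^+ 2 ->
  (q `^ (2 * `|r|))^-1 <= z `^ r <= q `^ (2 * `|r|).
Proof.
move=> q1 /andP[z1 z2]; have q0 : 0 < q by exact: lt_trans q1.
have z0 : 0 < z by apply: lt_le_trans z1; rewrite invr_gt0 exprn_gt0.
have lz : `|ln z| <= 2 * ln q.
  have e2 : 2 * ln q = ln (q ^+ 2) by rewrite lnXn// mulr_natl.
  rewrite ler_norml e2 -lnV ?posrE ?exprn_gt0//.
  by rewrite !ler_ln ?posrE ?invr_gt0 ?exprn_gt0// z1 z2.
rewrite /powR !gt_eqF// -expRN !ler_expR -ler_norml normrM mulrAC mulrC.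
by rewrite ler_wpM2r.
Qed.

(** A step function of y written as the sum of its jumps a^l - a^(l-1), one for each level q^l b
    below y. In this form, averaging over the sample turns the indicators into exceedance counts. *)
Definition lvl (a q b y : R) (K : nat) : R :=
  1 + (1 - a^-1) * \sum_(1 <= l < K.+1) a ^+ l * (q ^+ l * b < y)%R%:R.

(** The sum telescopes to a^l, with l the number of levels passed. The lower bound q^l b / q is one
    step lower than needed for l > 0 because at l = 0 only y > b / q is known. *)
Lemma lvl_spec (a q b y : R) (K : nat) : a != 0 -> 1 < q -> 0 < b ->
  q^-1 * b < y -> y <= q ^+ K.+1 * b ->
  exists2 l, lvl a q b y K = a ^+ l & q ^+ l / q * b < y <= q ^+ l * q * b.
Proof.
move=> a0 q1 b0 yb; have q0 : 0 < q by exact: lt_trans q1.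
elim: K => [|K IH] yK.
  exists 0%N; first by rewrite /lvl big_geq// mulr0 addr0 expr0.
  by rewrite expr0 !mul1r yb; rewrite expr1 in yK.
have [yK1|yK1] := leP y (q ^+ K.+1 * b).
  have [l El Hl] := IH yK1; exists l => //.
  by rewrite -El /lvl big_nat_recr//= ltNge yK1 mulr0 addr0.
exists K.+1; last first.
  rewrite -exprSr yK andbT (le_lt_trans _ yK1)// ler_pM2r// ler_pdivrMr//.
  by rewrite ler_peMr ?exprn_ge0 ?ltW.
rewrite /lvl.
rewrite (_ : \sum_(1 <= l < K.+2) _ = \sum_(1 <= l < K.+2) a ^+ l); last first.
  apply: eq_big_nat => l /andP[_ lK]; rewrite (le_lt_trans _ yK1) ?mulr1//.
  by rewrite ler_pM2r// ler_weXn2l// ltW.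
have H n : (1 - a^-1) * \sum_(1 <= l < n.+1) a ^+ l = a ^+ n - 1.
  elim: n => [|n IHn]; first by rewrite big_geq// mulr0 expr0 subrr.
  by rewrite big_nat_recr//= mulrDr IHn exprS; field.
by rewrite H; ring.
Qed.

Definition level_sum (a q b : R) (k : nat) (s : seq R) (K : nat) : R :=
  1 + (1 - a^-1) *
    \sum_(1 <= l < K.+1) a ^+ l * ((exceed (q ^+ l * b) s)%:R / k%:R).

(** Each top value y is within a factor q of its level q^l b, and the threshold Y within a factor q
    of b, so (y/Y)^r and q^(l r) differ by a factor at most q^(2|r|). [K0] depends on the sample:
    the levels up to q^(K0+1) b must cover its maximum. *)
Lemma Gstat_level_bounds (q b r : R) (k : nat) (s : seq R) :
  1 < q -> 0 < b -> (0 < k < size s)%N ->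
  q^-1 * b < ostat s (size s - k) <= q * b ->
  exists K0, forall K, (K0 <= K)%N ->
  (q `^ (2 * `|r|))^-1 * level_sum (q `^ r) q b k s K <= Gstat k r 0 s
    <= q `^ (2 * `|r|) * level_sum (q `^ r) q b k s K.
Proof.
move=> q1 b0 /andP[k0 ks]; set Y := ostat _ _ => /andP[bY Yb].
have q0 : 0 < q by exact: lt_trans q1.
have Y0 : 0 < Y by apply: lt_trans bY; rewrite mulr_gt0// invr_gt0.
set a := q `^ r; have a0 : 0 < a by exact: powR_gt0.
set W := q `^ _; have W0 : 0 < W by exact: powR_gt0.
have kR : 0 < k%:R :> R by rewrite ltr0n.
have [K0 HK0] : exists K0, forall K, (K0 <= K)%N -> forall y, y \in s -> y <= q ^+ K.+1 * b.
  have qoo : q ^+ n * b @[n --> \oo] --> +oo.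
    have [e e0 qe] : exists2 e, 0 < e & q = 1 + e by exists (q - 1); lra.
    apply/cvgryPge => A; near=> n.
    (* Bernoulli's inequality (1 + e)^n >= 1 + n e, proved by induction below. *)
    apply: (@le_trans _ _ ((1 + n%:R * e) * b)).
      rewrite mulrDl mul1r -lerBlDl -mulrA -ler_pdivrMr ?mulr_gt0//.
      by near: n; exact: nbhs_infty_ger.
    rewrite ler_wpM2r ?(ltW b0)// qe.
    elim: (n) => [|i IHi]; first by rewrite mul0r addr0 expr0.
    rewrite exprS; apply: (le_trans _ (ler_wpM2l _ IHi)); last by rewrite addr_ge0// ltW.
    have : 0 <= i%:R * e * e by rewrite !mulr_ge0// ltW.
    by rewrite -[i.+1]addn1 natrD; nra.
  elim: s {ks Y bY Yb Y0} => [|x s [K0 IH]]; first by exists 0%N.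
  have [N _ HN] : \forall n \near \oo, x <= q ^+ n * b by have /cvgryPge := qoo; apply.
  exists (maxn K0 N) => K; rewrite geq_max => /andP[K0K NK] y.
  rewrite inE => /orP[/eqP ->|/IH]; last by apply.
  by apply: HN; rewrite /= ltnW// ltnS.
exists K0 => K K0K; set S := level_sum _ _ _ _ _ _.
have SE : S = k%:R^-1 * \sum_(y <- top k s) lvl a q b y K.
  rewrite /S /level_sum /lvl big_split/= big_const_seq count_predT size_top ?(ltnW ks)// iter_addr_0.
  rewrite mulrDr -mulr_natl mulr1 mulVf ?gt_eqF//; congr (_ + _).
  rewrite -mulr_sumr mulrCA; congr (_ * _).
  rewrite exchange_big/= mulr_sumr; apply: eq_big_nat => l /andP[l1 _].
  rewrite -mulr_sumr [RHS]mulrCA; congr (_ * _); rewrite mulrC; congr (_ * _).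
  (* Since l >= 1, the level q^l b is at least q b, hence at least the threshold, so all exceedances
     are among the top k values. *)
  rewrite (@exceed_top _ k)//; last first.
    rewrite (le_trans Yb)// ler_pM2r// -[leLHS]expr1 ler_weXn2l// ltW//.
  by rewrite -sum1_count big_mkcond natr_sum; apply: eq_bigr => y _; case: ifP.
have bnd y : y \in top k s -> W^-1 * lvl a q b y K <= gfun r 0 (y / Y) <= W * lvl a q b y K.
  move=> yt; have Yy := top_ge ks yt.
  have ys : y \in s by rewrite -(mem_sort <=%R) (mem_drop yt).
  have [] := @lvl_spec a q b y K _ q1 b0 (lt_le_trans bY Yy) (HK0 _ K0K _ ys).
    by rewrite gt_eqF.
  move=> l -> /andP[y1 y2].
  have ql : 0 < q ^+ l by rewrite exprn_gt0.
  have aE : a ^+ l = (q ^+ l) `^ r.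
    by rewrite -powR_mulrn ?ltW// -powRrM -powR_mulrn ?ltW// -powRrM mulrC.
  have y0 : 0 < y by exact: lt_le_trans Yy.
  have zE : gfun r 0 (y / Y) = (q ^+ l) `^ r * (y / Y / q ^+ l) `^ r.
    rewrite /gfun expr0 mulr1 -powRM ?divr_ge0 ?ltW//.
    by rewrite [q ^+ l * _]mulrC divfK// gt_eqF.
  have /(powR_btw r q1)/andP[z1 z2] : q ^- 2 <= y / Y / q ^+ l <= q ^+ 2.
    apply/andP; split.
      rewrite ler_pdivlMr// ler_pdivlMr// (le_trans _ (ltW y1))//.
      rewrite (le_trans (ler_wpM2l _ Yb))//.
        by rewrite mulr_ge0 ?invr_ge0 ?exprn_ge0// ltW.
      by rewrite le_eqVlt; apply/orP; left; apply/eqP; field; rewrite gt_eqF.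
    rewrite ler_pdivrMr// ler_pdivrMr// (le_trans y2)//.
    apply: le_trans (ler_wpM2l _ (ltW bY)); last first.
      by rewrite mulr_ge0 ?exprn_ge0// ltW.
    by rewrite le_eqVlt; apply/orP; left; apply/eqP; field; rewrite gt_eqF.
  rewrite zE aE ![_ * (q ^+ l) `^ r]mulrC !ler_pM2l ?powR_gt0//.
  by rewrite z1 z2.
rewrite SE GstatE ?(ltnW ks)// -/Y !(mulrCA _ k%:R^-1) !ler_pM2l ?invr_gt0//.
rewrite !mulr_sumr; apply/andP; split.
  by rewrite !big_seq; apply: ler_sum => y /bnd/andP[].
by rewrite !big_seq; apply: ler_sum => y /bnd/andP[].
Unshelve. all: by end_near. Qed.

End levels.

(** * Convergence of G(k, r, 0) and G(k, r, 1) *)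

Section Gstat_cvg.
Context d (T : measurableType d) (R : realType) (P : probability T R).
Variable X : nat -> {RV P >-> R}.
Hypothesis X_indep : mutually_independent X.
Hypothesis X_id : identically_distributed X.
Hypothesis X_ge0 : forall i w, 0 <= X i w.
Variable gamma : R.
Hypothesis gamma0 : 0 < gamma.
Let U := quantile_U (X 0%N).
Hypothesis RV : forall x : R, 0 < x -> (fun t => U (t * x) / U t) @ +oo --> x `^ gamma.
Variables m k : nat -> nat.
Hypothesis k_oo : (k n)%:R @[n --> \oo] --> (+oo : set_system R).
Hypothesis mk_oo : (m n)%:R / (k n)%:R @[n --> \oo] --> (+oo : set_system R).
Let b n := U ((m n)%:R / (k n)%:R).
Let smp (x : nat * T) := sample X (m x.1) x.2.
Let exceed_cvg' := exceed_cvg X_indep X_id X_ge0 gamma0 RV k_oo mk_oo.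

Lemma k_lt_m : \forall n \near \oo, (0 < k n < m n)%N.
Proof.
near=> n.
have k0 : 0 < (k n)%:R :> R by near: n; exact: (k_gt0 k_oo).
have : 1 < (m n)%:R / (k n)%:R :> R by near: n; have /cvgryPgt/(_ 1) := mk_oo.
by rewrite ltr_pdivlMr// mul1r ltr_nat => ->; rewrite -(ltr0n R) k0.
Unshelve. all: by end_near. Qed.

(** The normalised counts at b / q and q b have limits q^(1/gamma) > 1 and q^(-1/gamma) < 1, so more
    than k values exceed b / q and fewer than k exceed q b. *)
Lemma ostat_near_b (q : R) : 1 < q -> \forall x \near whp P,
  q^-1 * b x.1 < ostat (smp x) (size (smp x) - k x.1) <= q * b x.1.
Proof.
move=> q1; have q0 : 0 < q by exact: lt_trans q1.
have lnq : 0 < ln q by rewrite ln_gt0.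
have H1 : 1 < (q^-1) `^ (- gamma^-1).
  rewrite /powR gt_eqF ?invr_gt0// expR_gt1 lnV ?posrE// mulrNN.
  by rewrite mulr_gt0// invr_gt0.
have H2 : q `^ (- gamma^-1) < 1.
  rewrite /powR gt_eqF// expR_lt1 mulNr oppr_lt0.
  by rewrite mulr_gt0// invr_gt0.
have iq0 : 0 < q^-1 by rewrite invr_gt0.
have N1 : \forall x \near whp P, (1 : R) < (exceed (q^-1 * b x.1) (smp x))%:R / (k x.1)%:R.
  by apply: (cvgr_gt _ (exceed_cvg' iq0)); exact: H1.
have N2 : \forall x \near whp P, (exceed (q * b x.1) (smp x))%:R / (k x.1)%:R < (1 : R).
  by apply: (cvgr_lt _ (exceed_cvg' q0)); exact: H2.
apply: filterS3 (whp_near P k_lt_m) N2 N1 => x /andP[k0 km].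
have kR : 0 < (k x.1)%:R :> R by rewrite ltr0n.
have sz : size (smp x) = m x.1 by rewrite size_map size_iota.
rewrite ltr_pdivlMr// ltr_pdivrMr// !mul1r !ltr_nat => h1 h2.
by rewrite ostat_gt ?sz// -?sz ?ostat_le ?sz// ltnW.
Qed.

Lemma ostat_gt0_near : \forall x \near whp P,
  0 < ostat (smp x) (size (smp x) - k x.1).
Proof.
have b0 : \forall n \near \oo, 0 < b n by exact: (b_gt0 X_ge0 RV mk_oo).
have H : 1 < 2 :> R by rewrite ltr1n.
apply: filterS2 (ostat_near_b H) (whp_near P b0) => x /andP[h _] b0x.
by apply: lt_trans h; rewrite mulr_gt0// invr_gt0.
Qed.

Variable r : R.
Hypothesis gr : gamma * r < 1.

(** The limit is the geometric series of ratio a p. The levels below a fixed L converge one by one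
    by [exceed_cvg]; the rest is bounded by [exceed_tail], uniformly in n. Truncation at any K >=
    [K0] is allowed since the cutoff of [Gstat_level_bounds] varies with the sample. *)
Lemma exceed_series_cvg (q eps : R) : 1 < q -> 0 < eps ->
  let a := q `^ r in let p := q `^ (- gamma^-1) in
  \forall x \near whp P, exists K0, forall K, (K0 <= K)%N ->
   `|\sum_(1 <= l < K.+1) a ^+ l * ((exceed (q ^+ l * b x.1) (smp x))%:R / (k x.1)%:R)
     - (a * p) / (1 - a * p)| <= eps.
Proof.
move=> q1 eps0 a p; have q0 : 0 < q by exact: lt_trans q1.
have lnq : 0 < ln q by rewrite ln_gt0.
have a0 : 0 < a by exact: powR_gt0.
have p0 : 0 < p by exact: powR_gt0.
have ig0 : 0 < gamma^-1 by rewrite invr_gt0.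
have rg : r < gamma^-1 by rewrite -[ltRHS]mul1r ltr_pdivlMr// mulrC.
have powq x : q `^ x = expR (x * ln q) by rewrite /powR gt_eqF.
have ltq x y : x < y -> q `^ x < q `^ y by move=> xy; rewrite !powq ltr_expR ltr_pM2r.
(* The exponent s is the midpoint of max(r, 0) and 1/gamma. Then theta = q^(-(s+r)/2) exceeds q^(-s)
   while a theta = q^((r-s)/2) stays below 1. *)
have [s [s0 sg rs]] : exists s, [/\ 0 <= s, s < gamma^-1 & r < s].
  exists ((Num.max r 0 + gamma^-1) / 2).
  have : Num.max r 0 < gamma^-1 by rewrite gt_max rg.
  have : 0 <= Num.max r 0 by rewrite le_max lexx orbT.
  have : r <= Num.max r 0 by rewrite le_max lexx.
  by move=> *; split; lra.
pose theta := q `^ (- ((s + r) / 2)).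
have t0 : 0 < theta by exact: powR_gt0.
have st : q `^ (- s) < theta by apply: ltq; lra.
pose z := a * theta; pose z' := a * p.
have z0 : 0 < z by rewrite mulr_gt0.
have z'0 : 0 < z' by rewrite mulr_gt0.
have z1 : z < 1.
  rewrite /z /a /theta -powRD; last by rewrite (gt_eqF q0) implybT.
  by rewrite -[ltRHS](powRr0 q); apply: ltq; lra.
have z'1 : z' < 1.
  rewrite /z' /a /p -powRD; last by rewrite (gt_eqF q0) implybT.
  by rewrite -[ltRHS](powRr0 q); apply: ltq; lra.
have nz : `|z| < 1 by rewrite ger0_norm// ltW.
have nz' : `|z'| < 1 by rewrite ger0_norm// ltW.
have e30 : 0 < eps / 3 by rewrite divr_gt0.
have [L1 _ HL1] : \forall L \near \oo, z ^+ L / (1 - z) <= eps / 3.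
  have := cvg_geometric (1 - z)^-1 nz.
  by move=> /(cvgr_le (0 : R))/(_ _ e30); apply: filterS => L; rewrite /geometric/= mulrC.
have [L2 _ HL2] : \forall L \near \oo, `|z' / (1 - z') - \sum_(1 <= l < L.+1) z' ^+ l| <= eps / 3.
  have := @cvg_geometric_series _ z' z' nz'.
  move=> /(@cvgr_dist_le _ _ _ _ _)/(_ _ e30); apply: filterS => L.
  by have := geometric_partial_tail L 1 z'; rewrite add1n expr1 => ->.
move=> e e0; have e20 : 0 < e / 2 by rewrite divr_gt0.
have sgam : s * gamma < 1 by rewrite -ltr_pdivlMr// mul1r.
have [L0 HL0] := exceed_tail X_id X_ge0 RV k_oo mk_oo q1 s0 sgam st e20.
have [L' [LL0 LL1 LL2]] : exists L', [/\ (L0 <= L'.+1)%N, (L1 <= L'.+1)%N & (L2 <= L')%N].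
  exists (maxn L0 (maxn L1 L2)); split.
  - by rewrite leqW// leq_maxl.
  - by rewrite leqW// !leq_max leqnn orbT.
  - by rewrite !leq_max leqnn !orbT.
pose L := L'.+1.
have fin : \sum_(1 <= l < L) a ^+ l * ((exceed (q ^+ l * b x.1) (smp x))%:R / (k x.1)%:R)
    @[x --> whp P] --> \sum_(1 <= l < L) z' ^+ l.
  apply: (@cvg_big _ _ +%R 0) => [|l _]; first exact: add_continuous.
  rewrite exprMn; apply: cvgM; first exact: cvg_cst.
  have -> : p ^+ l = (q ^+ l) `^ (- gamma^-1).
    by rewrite -powR_mulrn ?ltW// -powRrM -powR_mulrn ?(ltW q0)// -powRrM mulrC.
  by apply: exceed_cvg'; rewrite exprn_gt0.
move: fin => /(@cvgr_dist_le _ _ _ _ _)/(_ _ e30) fin1; have fin2 := fin1 _ e20.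
near=> n.
have [A1 [mA1 HA1 PA1]] : exists A : set T, [/\ measurable A,
    (forall w, A w -> forall l, (L <= l)%N ->
       (exceed (q ^+ l * b n) (sample X (m n) w))%:R <= (k n)%:R * theta ^+ l)
    & (P (~` A) <= (e / 2)%:E)%E].
  by near: n; exact: (HL0 L LL0).
have [A2 [mA2 HA2 PA2]] : exists A : set T, [/\ measurable A,
    (forall w, A w -> `|\sum_(1 <= l < L) z' ^+ l -
      \sum_(1 <= l < L) a ^+ l * ((exceed (q ^+ l * b n) (smp (n, w)))%:R / (k n)%:R)| <= eps / 3)
    & (P (~` A) <= (e / 2)%:E)%E].
  by near: n; exact: fin2.
have kn0 : 0 < (k n)%:R :> R by near: n; exact: (k_gt0 k_oo).
exists (A1 `&` A2); split.
- exact: measurableI.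
- move=> w [/HA1 h1 /HA2 h2]; exists L => K LK /=.
  rewrite (@big_cat_nat _ _ _ L)//=; last by rewrite ltnW.
  pose S1 := \sum_(1 <= l < L) a ^+ l * ((exceed (q ^+ l * b n) (smp (n, w)))%:R / (k n)%:R).
  set S2 := \sum_(L <= l < K.+1) _.
  have {}h2 : `|\sum_(1 <= l < L) z' ^+ l - S1| <= eps / 3 := h2.
  have S20 : 0 <= S2 by apply: sumr_ge0 => l _; rewrite !mulr_ge0 ?exprn_ge0 ?invr_ge0// ltW.
  have S2e : S2 <= eps / 3.
    apply: (@le_trans _ _ (z ^+ L / (1 - z))); last exact: HL1.
    apply: (@le_trans _ _ (\sum_(L <= l < K.+1) z ^+ l)).
      apply: ler_sum_nat => l /andP[Ll _].
      rewrite exprMn ler_wpM2l ?exprn_ge0 ?(ltW a0)// ler_pdivrMr// [leRHS]mulrC.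
      exact: h1.
    rewrite -(subnKC (leqW LK)) geometric_partial_tail.
    by apply: geometric_le_lim => //; rewrite exprn_ge0// ltW.
  have h3 : `|z' / (1 - z') - \sum_(1 <= l < L) z' ^+ l| <= eps / 3.
    exact: (HL2 _ LL2).
  rewrite -/S1; move: h2 h3; rewrite -/z' !ler_norml => /andP[? ?] /andP[? ?].
  by apply/andP; split; lra.
- rewrite setCI (le_trans (measureU2 _ _ _))//; try exact: measurableC.
  by rewrite (splitr e) EFinD leeD.
Unshelve. all: by end_near. Qed.

(** For q = e^h, al = 1/gamma and be = 1/gamma - r, H is (1 - e^(-al h)) / (1 - e^(-be h)). The
    inequalities x / (1 + x) <= 1 - e^(-x) <= x enclose it between (al/be) / (1 + al h) and (al/be)
    (1 + be h). As h tends to 0, W tends to 1 and both bounds to al/be = 1 / (1 - gamma r). *)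
Lemma level_limits (e : R) : 0 < e -> exists2 q, 1 < q &
  let W := q `^ (2 * `|r|) in
  let H := (1 - q `^ (- gamma^-1)) / (1 - q `^ r * q `^ (- gamma^-1)) in
  W * H <= (1 - gamma * r)^-1 + e /\ (1 - gamma * r)^-1 - e <= W^-1 * H.
Proof.
move=> e0; pose al := gamma^-1; pose be := al - r.
have al0 : 0 < al by rewrite invr_gt0.
have be0 : 0 < be by rewrite subr_gt0 -[ltRHS]mul1r ltr_pdivlMr// mulrC.
have lE : (1 - gamma * r)^-1 = al / be.
  have g1 : gamma != 0 by rewrite gt_eqF.
  have -> : be = (1 - gamma * r) / gamma by rewrite /be /al; field.
  by rewrite invf_div /al mulKf.
pose f (h : R) : R := expR (2 * `|r| * h) * (al / be * (1 + be * h)).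
pose g (h : R) : R := (expR (2 * `|r| * h))^-1 * (al / be / (1 + al * h)).
have cM (c : R) : c * h @[h --> (0 : R)] --> (0 : R).
  rewrite -[X in _ --> X](mulr0 c).
  by apply: cvgM; [exact: cvg_cst | exact: cvg_id].
have cE : expR (2 * `|r| * h) @[h --> (0 : R)] --> (1 : R).
  by rewrite -[X in _ --> X]expR0; exact: (continuous_cvg _ (@continuous_expR R 0) (cM _)).
have cL (c : R) : 1 + c * h @[h --> (0 : R)] --> (1 : R).
  rewrite -[X in _ --> X]addr0.
  by apply: cvgD; [exact: cvg_cst | exact: cM].
have cf : f h @[h --> 0^'+] --> al / be.
  apply: cvg_at_right_filter; rewrite -[X in _ --> X]mul1r; apply: cvgM => //.
  by rewrite -[X in _ --> X]mulr1; apply: cvgM => //; exact: cvg_cst.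
have cV (u : R -> R) : u h @[h --> (0 : R)] --> (1 : R) -> (u h)^-1 @[h --> (0 : R)] --> (1 : R).
  by move=> u1; rewrite -[X in _ --> X]invr1; apply: cvgV => //; exact: oner_neq0.
have cg : g h @[h --> 0^'+] --> al / be.
  apply: cvg_at_right_filter; rewrite -[X in _ --> X]mul1r; apply: cvgM; first exact: cV.
  by rewrite -[X in _ --> X]mulr1; apply: cvgM; [exact: cvg_cst | exact: cV].
have [h [h0 fh gh]] : exists h, [/\ 0 < h, f h <= al / be + e & al / be - e <= g h].
  apply: (@filter_ex _ (0 : R)^'+).
  have H1 : al / be < al / be + e by rewrite ltrDl.
  have H2 : al / be - e < al / be by rewrite ltrBlDr ltrDl.
  by near=> h; split; near: h; [exact: nbhs_right_gt | exact: (cvgr_le _ cf) | exact: (cvgr_ge _ cg)].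
exists (expR h); first by rewrite expR_gt1.
have powE x : expR h `^ x = expR (x * h) by rewrite mulrC expRM.
rewrite /= !powE -expRD -mulrDl -/al lE.
have -> : r + - al = - be by rewrite /be; ring.
rewrite !mulNr.
have ah0 : 0 < al * h by rewrite mulr_gt0.
have bh0 : 0 < be * h by rewrite mulr_gt0.
have up (x : R) : 1 - expR (- x) <= x by have := expR_ge1Dx (- x); lra.
have lo (x : R) : 0 < x -> x / (1 + x) <= 1 - expR (- x).
  move=> x0; have x1 : 0 < 1 + x by lra.
  have -> : x / (1 + x) = 1 - (1 + x)^-1 by field; rewrite gt_eqF.
  by rewrite lerD2l lerN2 expRN lef_pV2 ?posrE ?expR_gt0// expR_ge1Dx.
have D0 : 0 < 1 - expR (- (be * h)) by rewrite subr_gt0 expR_lt1 oppr_lt0.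
split.
  apply: le_trans fh; rewrite /f ler_pM2l ?expR_gt0// ler_pdivrMr//.
  apply: (le_trans (up _)).
  have := lo _ bh0; rewrite ler_pdivrMr; last lra.
  move=> hb; have -> : al * h = al / be * (be * h) by field; rewrite gt_eqF.
  by rewrite -[leRHS]mulrA ler_pM2l ?divr_gt0// [leRHS]mulrC.
apply: (le_trans gh); rewrite /g ler_pM2l ?invr_gt0 ?expR_gt0// ler_pdivlMr//.
apply: le_trans (lo _ ah0); rewrite mulrAC ler_pM2r ?invr_gt0; last lra.
have -> : al * h = al / be * (be * h) by field; rewrite gt_eqF.
by rewrite ler_pM2l ?divr_gt0.
Unshelve. all: by end_near. Qed.

Lemma Gstat0_cvg : Gstat (k x.1) r 0 (smp x) @[x --> whp P] --> (1 - gamma * r)^-1.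
Proof.
apply/cvgrPdist_le => e e0; have e20 : 0 < e / 2 by rewrite divr_gt0.
have [q q1 /=] := level_limits e20.
set W := q `^ _; set p := q `^ (- gamma^-1); set a := q `^ r => -[WH1 WH2].
have q0 : 0 < q by exact: lt_trans q1.
have a0 : 0 < a by exact: powR_gt0.
have W1 : 1 <= W by rewrite /W -[leLHS](powRr0 q) ler_powR ?mulr_ge0// ltW.
have W0 : 0 < W by exact: lt_le_trans W1.
have ap1 : a * p < 1.
  rewrite /a /p -powRD; last by rewrite (gt_eqF q0) implybT.
  rewrite /powR gt_eqF// expR_lt1 pmulr_llt0 ?ln_gt0//.
  by rewrite subr_lt0 -[ltRHS]mul1r ltr_pdivlMr// mulrC.
set H := _ / _ in WH1 WH2.
(* [H] is the limit of the level sums for fixed q. *)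
have HE : H = 1 + (1 - a^-1) * (a * p / (1 - a * p)).
  have dN : 1 - a * p != 0 by rewrite subr_eq0 gt_eqF.
  have aN : a != 0 by rewrite gt_eqF.
  by apply: (mulIf dN); rewrite /H [LHS]divfK// [RHS]mulrDl mul1r -[(1 - a^-1) * _ * _]mulrA divfK//; field.
pose c := 1 + `|1 - a^-1|; have c0 : 0 < c by rewrite ltr_pwDl.
(* The tolerance on the series is divided by what later multiplies it: |1 - 1/a| < c, then the
   rounding factor W. *)
pose d1 := e / 2 / W / c; have d10 : 0 < d1 by rewrite !divr_gt0.
have := exceed_series_cvg q1 d10 => /=; rewrite -/a -/p => Hs.
have NB : \forall n \near \oo, (0 < k n < m n)%N /\ 0 < b n.
  near=> n; split; near: n; [exact: k_lt_m | exact: (b_gt0 X_ge0 RV mk_oo)].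
apply: filterS3 (ostat_near_b q1) Hs (whp_near P NB) => x Hq [K0 HK0] [/andP[k0 km] b0].
have sz : size (smp x) = m x.1 by rewrite size_map size_iota.
have k0m : (0 < k x.1 < size (smp x))%N by rewrite sz k0.
have [K1 HK1] := Gstat_level_bounds r q1 b0 k0m Hq.
have {HK1} := HK1 (maxn K0 K1) (leq_maxr _ _); rewrite -/a -/W.
have {HK0} := HK0 (maxn K0 K1) (leq_maxl _ _).
rewrite /level_sum; set S := \sum_(1 <= l < _) _ => hS.
have hS2 : `|1 + (1 - a^-1) * S - H| <= e / 2 / W.
  rewrite HE (_ : _ - _ = (1 - a^-1) * (S - a * p / (1 - a * p))); last by ring.
  rewrite normrM (le_trans (ler_wpM2l _ hS))// /d1 mulrC.
  by rewrite mulrAC ler_pdivrMr// ler_pM2l ?divr_gt0// /c lerDr.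
move: hS2; set S' := 1 + _ => hS2 /andP[G1 G2].
have iW0 : 0 < W^-1 by rewrite invr_gt0.
have iW1 : W^-1 <= 1 by rewrite invf_le1.
move: hS2; rewrite ler_norml => /andP[h1 h2].
have k1 : W * (S' - H) <= e / 2.
  by rewrite mulrC -ler_pdivlMr.
have k2 : W^-1 * (H - S') <= e / 2.
  apply: (@le_trans _ _ (W^-1 * (e / 2 / W))).
    by rewrite ler_pM2l//; lra.
  rewrite mulrCA -[leRHS]mulr1 ler_pM2l// -[leRHS]mulr1.
  by apply: ler_pM => //; exact: ltW.
rewrite mulrBr in k1; rewrite mulrBr in k2.
by rewrite ler_distlC; apply/andP; split; lra.
Unshelve. all: by end_near. Qed.

End Gstat_cvg.

(* The tangent inequality for the convex function G(k, ., 0), of derivative G(k, ., 1). *)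
Lemma Gstat_convex (R : realType) (k : nat) (r h : R) (s : seq R) :
  (k < size s)%N -> 0 < ostat s (size s - k) ->
  Gstat k r 0 s + h * Gstat k r 1 s <= Gstat k (r + h) 0 s.
Proof.
move=> ks Y0; rewrite !GstatE ?(ltnW ks)// mulrCA -mulrDr ler_wpM2l ?invr_ge0//.
rewrite mulr_sumr -big_split/= !big_seq; apply: ler_sum => y yt.
have y0 : 0 < y := lt_le_trans Y0 (top_ge ks yt).
set z := y / _; have z0 : 0 < z by rewrite divr_gt0.
rewrite /gfun expr0 !mulr1 expr1 powRD; last by rewrite (gt_eqF z0) implybT.
rewrite mulrCA -{1}[z `^ r]mulr1 -mulrDr ler_wpM2l ?powR_ge0//.
(* This is z^h >= 1 + h ln z, valid for h of either sign. *)
by rewrite [X in _ <= X]/powR (gt_eqF z0) expR_ge1Dx.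
Qed.

Section Gstat1_cvg.
Context d (T : measurableType d) (R : realType) (P : probability T R).
Variable X : nat -> {RV P >-> R}.
Hypothesis X_indep : mutually_independent X.
Hypothesis X_id : identically_distributed X.
Hypothesis X_ge0 : forall i w, 0 <= X i w.
Variable gamma : R.
Hypothesis gamma0 : 0 < gamma.
Let U := quantile_U (X 0%N).
Hypothesis RV : forall x : R, 0 < x -> (fun t => U (t * x) / U t) @ +oo --> x `^ gamma.
Variables m k : nat -> nat.
Hypothesis k_oo : (k n)%:R @[n --> \oo] --> (+oo : set_system R).
Hypothesis mk_oo : (m n)%:R / (k n)%:R @[n --> \oo] --> (+oo : set_system R).
Let smp (x : nat * T) := sample X (m x.1) x.2.

(** By convexity, G(k, r, 1) lies between the backward and forward difference quotients of G(k, .,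
    0) with step h. Their limits in probability are the difference quotients of 1 / (1 - gamma r),
    which tend to its derivative as h tends to 0. *)
Lemma Gstat1_cvg (r : R) : gamma * r < 1 ->
  Gstat (k x.1) r 1 (smp x) @[x --> whp P] --> gamma / (1 - gamma * r) ^+ 2.
Proof.
move=> gr; have G0 rr (h : gamma * rr < 1) :=
  Gstat0_cvg X_indep X_id X_ge0 gamma0 RV k_oo mk_oo h.
set D := 1 - gamma * r; have D0 : 0 < D by rewrite subr_gt0.
(* The limiting quotients in closed form: forward for c = gamma, backward for c = - gamma. *)
pose u (c h : R) := gamma / (D * (D - c * h)).
have cu c : u c h @[h --> 0^'+] --> gamma / D ^+ 2.
  apply: cvg_at_right_filter; apply: cvgM; first exact: cvg_cst.
  apply: cvgV; first by rewrite gt_eqF ?exprn_gt0.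
  rewrite expr2; apply: cvgM; first exact: cvg_cst.
  rewrite -[X in _ --> X]subr0 -[X in _ - X](mulr0 c).
  by apply: cvgB; [exact: cvg_cst | apply: cvgM; [exact: cvg_cst | exact: cvg_id]].
apply/cvgrPdist_le => e e0; have e20 : 0 < e / 2 by rewrite divr_gt0.
have [h [h0 gh uh1 uh2]] : exists h, [/\ 0 < h, gamma * h < D,
    u gamma h <= gamma / D ^+ 2 + e / 2 & gamma / D ^+ 2 - e / 2 <= u (- gamma) h].
  apply: (@filter_ex _ (0 : R)^'+).
  have H1 : gamma / D ^+ 2 < gamma / D ^+ 2 + e / 2 by rewrite ltrDl.
  have H2 : gamma / D ^+ 2 - e / 2 < gamma / D ^+ 2 by rewrite ltrBlDr ltrDl.
  near=> h; split; near: h.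
  - exact: nbhs_right_gt.
  - near=> h; rewrite mulrC -ltr_pdivlMr//; near: h.
    by apply: nbhs_right_lt; rewrite divr_gt0.
  - exact: (cvgr_le _ (cu gamma)).
  - exact: (cvgr_ge _ (cu (- gamma))).
have gp : gamma * (r + h) < 1 by rewrite mulrDr; move: gh; rewrite /D; lra.
have gm : gamma * (r - h) < 1.
  by rewrite mulrBr; have : 0 < gamma * h by [rewrite mulr_gt0]; lra.
have Cup : h^-1 * (Gstat (k x.1) (r + h) 0 (smp x) - Gstat (k x.1) r 0 (smp x))
    @[x --> whp P] --> u gamma h.
  have -> : u gamma h = h^-1 * ((1 - gamma * (r + h))^-1 - D^-1).
    have -> : 1 - gamma * (r + h) = D - gamma * h by rewrite /D; ring.
    have n1 : D - gamma * h != 0 by rewrite subr_eq0 gt_eqF.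
    by rewrite /u; field; rewrite n1 !gt_eqF.
  by apply: cvgM; [exact: cvg_cst | apply: cvgB; exact: G0].
have Clo : h^-1 * (Gstat (k x.1) r 0 (smp x) - Gstat (k x.1) (r - h) 0 (smp x))
    @[x --> whp P] --> u (- gamma) h.
  have -> : u (- gamma) h = h^-1 * (D^-1 - (1 - gamma * (r - h))^-1).
    have -> : 1 - gamma * (r - h) = D - - gamma * h by rewrite /D; ring.
    have n1 : D - - gamma * h != 0.
      by rewrite gt_eqF// mulNr opprK addr_gt0// mulr_gt0.
    by rewrite /u; field; rewrite n1 !gt_eqF.
  by apply: cvgM; [exact: cvg_cst | apply: cvgB; exact: G0].
have Eup : \forall x \near whp P, h^-1 * (Gstat (k x.1) (r + h) 0 (smp x) -
    Gstat (k x.1) r 0 (smp x)) <= gamma / D ^+ 2 + e.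
  apply: (cvgr_le _ Cup); apply: (le_lt_trans uh1); lra.
have Elo : \forall x \near whp P, gamma / D ^+ 2 - e <=
    h^-1 * (Gstat (k x.1) r 0 (smp x) - Gstat (k x.1) (r - h) 0 (smp x)).
  apply: (cvgr_ge _ Clo); apply: lt_le_trans uh2; lra.
have NB := whp_near P (k_lt_m k_oo mk_oo).
have Ypos := ostat_gt0_near X_indep X_id X_ge0 gamma0 RV k_oo mk_oo.
apply: filterS2 (filterI Eup Elo) (filterI NB Ypos) => x [up lo] [/andP[_ km] Y0].
have ks : (k x.1 < size (smp x))%N by rewrite size_map size_iota.
have C1 := Gstat_convex r h ks Y0; have C2 := Gstat_convex r (- h) ks Y0.
rewrite ler_distlC; apply/andP; split.
  apply: (le_trans lo); rewrite mulrC ler_pdivrMr//; move: C2; rewrite -/smp; lra.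
by apply: le_trans up; rewrite [leRHS]mulrC ler_pdivlMr//; move: C1; lra.
Unshelve. all: by end_near. Qed.

End Gstat1_cvg.

(** * The estimators as functions of G when one observation tends to infinity *)

Section asymptotics.
Variable R : realType.
Implicit Types (r z : R).

Lemma ln_cvgy : ln z @[z --> +oo] --> (+oo : set_system R).
Proof.
apply/cvgryPge => A; near=> z.
have z0 : expR A <= z by near: z; apply: nbhs_pinfty_ge; rewrite num_real.
by rewrite -[leLHS]expRK ler_ln ?posrE ?expR_gt0// (lt_le_trans _ z0) ?expR_gt0.
Unshelve. all: by end_near. Qed.

Lemma powR_cvgy r : 0 < r -> z `^ r @[z --> +oo] --> (+oo : set_system R).
Proof.
move=> r0; apply/cvgryPge => A; near=> z.
have z0 : 0 < z by near: z; apply: nbhs_pinfty_gt; rewrite num_real.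
rewrite /powR gt_eqF//; apply: le_trans (expR_ge1Dx _).
rewrite -lerBlDl mulrC -ler_pdivrMr//.
by near: z; have /cvgryPge := ln_cvgy; apply.
Unshelve. all: by end_near. Qed.

Lemma powRN_cvg0 r : r < 0 -> z `^ r @[z --> +oo] --> (0 : R).
Proof.
move=> r0; rewrite (_ : (fun z => z `^ r) = (fun z => (z `^ (- r))^-1)).
  apply/gtr0_cvgV0; last by apply: powR_cvgy; rewrite oppr_gt0.
  near=> z; apply: powR_gt0; near: z; apply: nbhs_pinfty_gt; rewrite num_real//.
by apply/funext => z; rewrite powRN invrK.
Unshelve. all: by end_near. Qed.

(** Half of the exponent absorbs the logarithm: with q = - r/2, q ln z <= z^q, so the product is at
    most z^(-q) / q. *)
Lemma powRN_ln_cvg0 r : r < 0 -> z `^ r * ln z @[z --> +oo] --> (0 : R).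
Proof.
move=> r0; pose q := - (r / 2); have q0 : 0 < q by rewrite oppr_gt0 pmulr_llt0.
have H : q^-1 * z `^ (r / 2) @[z --> +oo] --> (0 : R).
  rewrite -[X in _ --> X](mulr0 q^-1); apply: cvgM; first exact: cvg_cst.
  by apply: powRN_cvg0; rewrite pmulr_llt0.
apply: (squeeze_cvgr _ (cvg_cst (0 : R)) H).
near=> z; have z1 : 1 <= z by near: z; apply: nbhs_pinfty_ge; rewrite num_real.
have z0 : 0 < z by exact: lt_le_trans z1.
rewrite mulr_ge0 ?powR_ge0 ?ln_ge0//=.
rewrite {1}(splitr r) powRD; last by rewrite (gt_eqF z0) implybT.
rewrite -mulrA [leRHS]mulrC ler_wpM2l ?powR_ge0//.
have -> : z `^ (r / 2) = (z `^ q)^-1 by rewrite -powRN opprK.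
rewrite mulrC ler_pdivrMr ?powR_gt0// -ler_pdivrMl ?invr_gt0// invrK.
rewrite /powR (gt_eqF z0); apply: le_trans (expR_ge1Dx _); lra.
Unshelve. all: by end_near. Qed.

End asymptotics.

(** * The estimators as functions of the statistics G *)

Section phi.
Variable R : realType.
Implicit Types (r : R).

Definition phi2_den r (A1 : R) : R := 2 * r * A1 + 1 + Num.sqrt (4 * r * A1 + 1).

Definition phi (l : nat) r (A0 A1 A2 : R) : R :=
  match l with
  | 1 => if r == 0 then A1 else (A0 - 1) / (r * A0)
  | 2 => 2 * A1 / phi2_den r A1
  | _ => if r == 0 then A2 / (2 * A1) else (r * A1 - A0 + 1) / (r ^+ 2 * A1)
  end.

Lemma gamma_hatE l k r (s : seq R) :
  gamma_hat l k r s = phi l r (Gstat k r 0 s) (Gstat k r 1 s) (Gstat k r 2 s).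
Proof.
rewrite /gamma_hat /phi /gamma_hat1 /gamma_hat2 /gamma_hat3.
by case: l => [|[|[|l]]] //; case: eqP => // ->.
Qed.

Lemma phi_cvg (I : Type) (F : set_system I) {FF : Filter F} l r
    (u0 u1 u2 : I -> R) (a0 a1 a2 : R) : r != 0 -> (0 < l <= 3)%N ->
  u0 i @[i --> F] --> a0 -> u1 i @[i --> F] --> a1 ->
  (l = 1 -> a0 != 0) -> (l = 2 -> phi2_den r a1 != 0) -> (l = 3 -> a1 != 0) ->
  phi l r (u0 i) (u1 i) (u2 i) @[i --> F] --> phi l r a0 a1 a2.
Proof.
move=> r0 l3 c0 c1 h1 h2 h3; rewrite /phi (negPf r0).
have cc (a : R) : (fun=> a) i @[i --> F] --> a by exact: cvg_cst.
case: l l3 h1 h2 h3 => [|[|[|[|l]]]] // _ h1 h2 h3.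
- apply: cvgM; first by apply: cvgB.
  apply: cvgV; first by rewrite mulf_neq0// h1.
  by apply: cvgM.
- apply: cvgM; first by apply: cvgM.
  apply: cvgV; first exact: h2.
  rewrite /phi2_den; apply: cvgD.
    by apply: cvgD => //; apply: cvgM.
  apply: (continuous_cvg _ (@sqrt_continuous R _)).
  by apply: cvgD => //; apply: cvgM.
- apply: cvgM.
    by apply: cvgD => //; apply: cvgB => //; apply: cvgM.
  apply: cvgV; first by rewrite mulf_neq0 ?expf_neq0// h3.
  by apply: cvgM.
Qed.

Lemma phi2_den_gt0 r (x : R) : 0 <= 4 * r * x + 1 -> 0 < phi2_den r x.
Proof. by move=> h; rewrite /phi2_den; have := sqrtr_ge0 (4 * r * x + 1); lra. Qed.

(** With S the square root, x = (S^2 - 1) / (4 r) and the denominator is (S + 1)^2 / 2, so the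
    estimator is (S - 1) / (r (S + 1)), whose limit for large S is visible. *)
Lemma phi2_sqrtE r (x : R) : r != 0 -> 0 <= 4 * r * x + 1 ->
  phi 2 r 0 x 0 = r^-1 - 2 / (r * (Num.sqrt (4 * r * x + 1) + 1)).
Proof.
move=> r0 h; rewrite /phi /phi2_den; set S := Num.sqrt _.
have S2 : S ^+ 2 = 4 * r * x + 1 by rewrite sqr_sqrtr.
have S0 : 0 <= S by exact: sqrtr_ge0.
have -> : x = (S ^+ 2 - 1) / (4 * r) by rewrite S2; field.
have S1 : S + 1 != 0 by rewrite gt_eqF// ltr_wpDl.
have -> : 2 * r * ((S ^+ 2 - 1) / (4 * r)) + 1 + S = (S + 1) ^+ 2 / 2 by field.
by field; rewrite S1 r0.
Qed.

End phi.

(* The limits of the estimators when the largest observation z = x / Y (in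
   units of the threshold) tends to infinity; A0, A1, A2 are the statistics of
   the other observations. *)
Section blowup.
Variables (R : realType) (k : nat) (r A0 A1 A2 : R).
Hypothesis A0_gt0 : 0 < A0.
Hypothesis A1_ge0 : 0 <= A1.
Hypothesis A2_ge0 : 0 <= A2.
Variable j : nat.
Hypothesis j3 : (0 < j <= 3)%N.

Definition Gstat_add (u : nat) (A z : R) : R := k.+1%:R^-1 * (gfun r u z + k%:R * A).
Let est (z : R) : R := phi j r (Gstat_add 0 A0 z) (Gstat_add 1 A1 z) (Gstat_add 2 A2 z).
Let c : R := k%:R / k.+1%:R.

Let k1 : 0 < k.+1%:R :> R. Proof. by rewrite ltr0n. Qed.
Let ik1 : 0 < k.+1%:R^-1 :> R. Proof. by rewrite invr_gt0. Qed.

Lemma Gstat_add_cvgy u A : gfun r u z @[z --> +oo] --> (+oo : set_system R) ->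
  Gstat_add u A z @[z --> +oo] --> (+oo : set_system R).
Proof.
move=> gy; apply/cvgryPge => B; near=> z.
rewrite /Gstat_add mulrC ler_pdivlMr// -lerBlDr.
by near: z; have /cvgryPge := gy; apply.
Unshelve. all: by end_near. Qed.

Lemma Gstat_add_cvg0 u A : gfun r u z @[z --> +oo] --> (0 : R) ->
  Gstat_add u A z @[z --> +oo] --> c * A.
Proof.
move=> g0; have -> : c * A = k.+1%:R^-1 * (0 + k%:R * A) by rewrite /c; ring.
by apply: cvgM; [exact: cvg_cst | apply: cvgD => //; exact: cvg_cst].
Qed.

Lemma gfun1_gt0 (z : R) : 1 < z -> 0 < gfun r 1 z.
Proof.
move=> z1; rewrite /gfun expr1 mulr_gt0 ?ln_gt0// powR_gt0//.
exact: lt_trans z1.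
Qed.

(** For r = 0 the first two estimators reduce to G(k, 0, 1). The third is at least (ln z)^2 / (2 (ln
    z + k A1)), hence at least (ln z) / 4 once k A1 <= ln z. *)
Lemma est_r0 : r = 0 -> est z @[z --> +oo] --> (+oo : set_system R).
Proof.
move=> r0; have gE u (z : R) : gfun r u z = ln z ^+ u by rewrite /gfun r0 powRr0 mul1r.
have l1 : Gstat_add 1 A1 z @[z --> +oo] --> (+oo : set_system R).
  apply: Gstat_add_cvgy; rewrite (_ : gfun r 1 = @ln R); first exact: ln_cvgy.
  by apply/funext => z; rewrite gE expr1.
have rb : (r == 0) = true by rewrite r0 eqxx.
rewrite /est /phi rb; case: j j3 => [|[|[|[|]]]] // _.
- rewrite (_ : (fun z => _) = Gstat_add 1 A1)//; apply/funext => z.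
  by rewrite /phi2_den r0 !mulr0 !mul0r !add0r sqrtr1; field.
- apply/cvgryPge => B; near=> z.
  have z1 : 1 < z by near: z; apply: nbhs_pinfty_gt; rewrite num_real.
  have L0 : 0 < ln z by rewrite ln_gt0.
  have LA : k%:R * A1 <= ln z.
    by near: z; have /cvgryPge := @ln_cvgy R; apply.
  have LB : 4 * B <= ln z.
    by near: z; have /cvgryPge := @ln_cvgy R; apply.
  rewrite /Gstat_add !gE expr1.
  have kA1 : 0 <= k%:R * A1 by rewrite mulr_ge0.
  have kA2 : 0 <= k%:R * A2 by rewrite mulr_ge0.
  rewrite ler_pdivlMr; last by rewrite !mulr_gt0// ltr_pwDl.
  rewrite mulrA mulrCA ler_pM2l//.
  by have := ltW L0; nra.
Unshelve. all: by end_near. Qed.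

(** Each estimator is 1/r minus a vanishing term: 1 / (r G0), 2 / (r (S + 1)) with S the square root
    in the second estimator, and (G0 - 1) / (r^2 G1), where G1 outgrows G0 by a factor ln z. *)
Lemma est_rpos : 0 < r -> est z @[z --> +oo] --> r^-1.
Proof.
move=> r0; have rN : r != 0 by rewrite gt_eqF.
have g0 : Gstat_add 0 A0 z @[z --> +oo] --> (+oo : set_system R).
  apply: Gstat_add_cvgy; rewrite (_ : gfun r 0 = (fun z => z `^ r)); first exact: powR_cvgy.
  by apply/funext => z; rewrite /gfun expr0 mulr1.
have lnz : \forall z \near +oo, 1 <= ln z :> R by have /cvgryPge := @ln_cvgy R; apply.
have g1 : Gstat_add 1 A1 z @[z --> +oo] --> (+oo : set_system R).
  apply: Gstat_add_cvgy; apply: (ger_cvgy _ (powR_cvgy r0)).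
  by apply: filterS lnz => z h; rewrite /gfun expr1 ler_peMr// powR_ge0.
rewrite /est /phi (negPf rN); case: j j3 => [|[|[|[|]]]] // _.
- have H : r^-1 - r^-1 * (Gstat_add 0 A0 z)^-1 @[z --> +oo] --> r^-1.
    rewrite -[X in _ --> X]subr0; apply: cvgB; first exact: cvg_cst.
    rewrite -[X in _ --> X](mulr0 r^-1); apply: cvgM; first exact: cvg_cst.
    by apply/gtr0_cvgV0 => //; have /cvgryPgt := g0; apply.
  apply: cvg_trans H; apply: near_eq_cvg; near=> z.
  have : 0 < Gstat_add 0 A0 z by near: z; have /cvgryPgt := g0; apply.
  by move=> h; field; rewrite rN gt_eqF.
- pose S z := Num.sqrt (4 * r * Gstat_add 1 A1 z + 1).
  have Sy : S z + 1 @[z --> +oo] --> (+oo : set_system R).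
    apply/cvgryPge => B; near=> z.
    have hB : B ^+ 2 / (4 * r) <= Gstat_add 1 A1 z by near: z; have /cvgryPge := g1; apply.
    rewrite /S -[leLHS]addr0 lerD//.
    apply: (le_trans (ler_norm B)); rewrite -sqrtr_sqr; apply: ler_wsqrtr.
    by move: hB; rewrite ler_pdivrMr ?mulr_gt0//; lra.
  have H : r^-1 - 2 / r * (S z + 1)^-1 @[z --> +oo] --> r^-1.
    rewrite -[X in _ --> X]subr0; apply: cvgB; first exact: cvg_cst.
    rewrite -[X in _ --> X](mulr0 (2 / r)); apply: cvgM; first exact: cvg_cst.
    by apply/gtr0_cvgV0 => //; have /cvgryPgt := Sy; apply.
  apply: cvg_trans H; apply: near_eq_cvg; near=> z.
  have h : 0 < Gstat_add 1 A1 z by near: z; have /cvgryPgt := g1; apply.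
  have := @phi2_sqrtE _ r (Gstat_add 1 A1 z) rN; rewrite /phi -/(S z) => ->.
    by rewrite invfM mulrA.
  by have := mulr_gt0 r0 h; lra.
(* Once z^r >= 1, the numerator satisfies |z^r + k A0 - (k + 1)| <= z^r M. *)
- pose M := k%:R * A0 + 1 + k.+1%:R.
  have H0 : M * (ln z)^-1 @[z --> +oo] --> (0 : R).
    rewrite -[X in _ --> X](mulr0 M); apply: cvgM; first exact: cvg_cst.
    apply/gtr0_cvgV0; last exact: ln_cvgy.
    by apply: filterS lnz => z; exact: lt_le_trans.
  have H1 : (Gstat_add 0 A0 z - 1) / Gstat_add 1 A1 z @[z --> +oo] --> (0 : R).
    apply: norm_cvg0; apply: (squeeze_cvgr _ (cvg_cst (0 : R)) H0).
    near=> z.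
    have z1 : 1 < z by near: z; apply: nbhs_pinfty_gt; rewrite num_real.
    have L1 : 1 <= ln z by near: z.
    have L0 : 0 < ln z by exact: lt_le_trans L1.
    have Z1 : 1 <= z `^ r by rewrite -[leLHS](powRr0 z) ler_powR// ltW.
    have Z0 : 0 < z `^ r by exact: lt_le_trans Z1.
    have U1 : k.+1%:R^-1 * (z `^ r * ln z) <= Gstat_add 1 A1 z.
      by rewrite /Gstat_add /gfun expr1 ler_pM2l// lerDl mulr_ge0.
    have U10 : 0 < k.+1%:R^-1 * (z `^ r * ln z) by rewrite !mulr_gt0.
    rewrite normr_ge0 normrM normfV (gtr0_norm (lt_le_trans U10 U1)).
    rewrite ler_pdivrMr ?(lt_le_trans U10 U1)//.
    have U0 : `|Gstat_add 0 A0 z - 1| <= k.+1%:R^-1 * (z `^ r * M).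
      have kA : 0 <= k%:R * A0 by rewrite mulr_ge0// ltW.
      have -> : Gstat_add 0 A0 z - 1 = k.+1%:R^-1 * (z `^ r + k%:R * A0 - k.+1%:R).
        by rewrite /Gstat_add /gfun expr0; field; rewrite gt_eqF.
      rewrite normrM (gtr0_norm ik1) ler_pM2l// ler_norml /M.
      by move: Z1 kA (ltW k1); set q := k.+1%:R; move=> *; apply/andP; split; nra.
    apply: (le_trans U0).
    have M0 : 0 <= M by rewrite /M !addr_ge0 ?mulr_ge0// ltW.
    have -> : k.+1%:R^-1 * (z `^ r * M) = M / ln z * (k.+1%:R^-1 * (z `^ r * ln z)).
      by field; rewrite !gt_eqF.
    by rewrite ler_wpM2l// divr_ge0// ltW.
  have H : r^-1 - r ^- 2 * ((Gstat_add 0 A0 z - 1) / Gstat_add 1 A1 z) @[z --> +oo] --> r^-1.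
    rewrite -[X in _ --> X]subr0; apply: cvgB; first exact: cvg_cst.
    by rewrite -[X in _ --> X](mulr0 (r ^- 2)); apply: cvgM; first exact: cvg_cst.
  apply: cvg_trans H; apply: near_eq_cvg; near=> z.
  have : 0 < Gstat_add 1 A1 z by near: z; have /cvgryPgt := g1; apply.
  by move=> h; field; rewrite rN gt_eqF.
Unshelve. all: by end_near. Qed.

Lemma est_rneg : r < 0 ->
  (j = 2 -> phi2_den r (c * A1) != 0) -> (j = 3 -> c * A1 != 0) -> (0 < k)%N ->
  est z @[z --> +oo] --> phi j r (c * A0) (c * A1) (c * A2).
Proof.
move=> r0 h2 h3 k0; apply: phi_cvg => //.
- by rewrite lt_eqF.
- apply: Gstat_add_cvg0; rewrite (_ : gfun r 0 = (fun z => z `^ r)); first exact: powRN_cvg0.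
  by apply/funext => z; rewrite /gfun expr0 mulr1.
- apply: Gstat_add_cvg0; rewrite (_ : gfun r 1 = (fun z => z `^ r * ln z)); first exact: powRN_ln_cvg0.
  by apply/funext => z; rewrite /gfun expr1.
- by rewrite gt_eqF// mulr_gt0// divr_gt0// ltr0n.
Qed.

(** [Num.sqrt] is 0 on negative numbers, so the denominator vanishes exactly when 2 r c A1 = -1.
    Near this point it is 2 r dl, with dl > 0 tending to 0, while the numerator tends to -1/r >
    0. *)
Lemma est_rneg_den0 : r < 0 -> j = 2 -> phi2_den r (c * A1) = 0 ->
  est z @[z --> +oo] --> (-oo : set_system R).
Proof.
move=> r0 j2 d0; have rN : r != 0 by rewrite lt_eqF.
have neg : 4 * r * (c * A1) + 1 < 0.
  by rewrite ltNge; apply/negP => /phi2_den_gt0; rewrite d0 ltxx.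
have d1 : 2 * r * (c * A1) + 1 = 0.
  by move: d0; rewrite /phi2_den ler0_sqrtr ?addr0// ltW.
have cg : gfun r 1 z @[z --> +oo] --> (0 : R).
  rewrite (_ : gfun r 1 = (fun z => z `^ r * ln z)); first exact: powRN_ln_cvg0.
  by apply/funext => z; rewrite /gfun expr1.
rewrite /est j2 /phi; apply/cvgrNyPle => B.
(* Chosen so that -2 r q (|B| + 1) = -1/r, the limit of the numerator. *)
pose q := (r ^+ 2 * (`|B| + 1)) ^-1 / 2.
have r20 : 0 < r ^+ 2 by rewrite exprn_even_gt0.
have B0 : 0 < `|B| + 1 by rewrite ltr_wpDl.
have q0 : 0 < q by rewrite divr_gt0// invr_gt0 mulr_gt0.
near=> z.
have z1 : 1 < z by near: z; apply: nbhs_pinfty_gt; rewrite num_real.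
have g0 := gfun1_gt0 z1.
have gq : gfun r 1 z <= q by near: z; apply: (cvgr_le _ cg).
pose dl := k.+1%:R^-1 * gfun r 1 z.
have dl0 : 0 < dl by rewrite mulr_gt0.
have dlq : dl <= q.
  apply: le_trans gq; rewrite /dl ler_piMl ?(ltW g0)//.
  by rewrite invf_le1// ler1n.
have uE : Gstat_add 1 A1 z = c * A1 + dl by rewrite /Gstat_add /dl /c; ring.
have rdl : r * dl < 0 by rewrite nmulr_rlt0.
have s0 : Num.sqrt (4 * r * Gstat_add 1 A1 z + 1) = 0.
  by apply: ler0_sqrtr; rewrite uE; lra.
have dE : phi2_den r (Gstat_add 1 A1 z) = 2 * r * dl.
  by rewrite /phi2_den s0 uE; lra.
rewrite dE ler_ndivrMr; last by lra.
apply: (@le_trans _ _ (- (2 * r * dl) * (`|B| + 1))).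
  have nd : 0 < - (2 * r * dl) by lra.
  rewrite -[B * _]mulrNN mulrC ler_pM2l//.
  by have := ler_norm (- B); rewrite normrN; lra.
rewrite uE.
have cA : 2 * (c * A1) = - r^-1.
  by apply: (mulfI rN); rewrite mulrN mulfV//; lra.
have h1 : - (2 * r * dl) * (`|B| + 1) <= - r^-1.
  have -> : - r^-1 = - (2 * r * q) * (`|B| + 1).
    by rewrite /q; field; rewrite rN gt_eqF.
  rewrite ler_pM2r//; nra.
lra.
Unshelve. all: by end_near. Qed.

(** The denominator tends to 0 from above, while the numerator tends to 1 - c A0, which is positive
    because A0 <= 1 and c < 1. *)
Lemma est_rneg_A1_0 : r < 0 -> A0 <= 1 -> j = 3 -> A1 = 0 ->
  est z @[z --> +oo] --> (+oo : set_system R).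
Proof.
move=> r0 A01 jE A10; have rN : r != 0 by rewrite lt_eqF.
have c1 : Gstat_add 1 A1 z @[z --> +oo] --> (0 : R).
  rewrite -[X in _ --> X](mulr0 c) -A10; apply: Gstat_add_cvg0.
  rewrite (_ : gfun r 1 = (fun z => z `^ r * ln z)); first exact: powRN_ln_cvg0.
  by apply/funext => z; rewrite /gfun expr1.
have c0 : Gstat_add 0 A0 z @[z --> +oo] --> c * A0.
  apply: Gstat_add_cvg0; rewrite (_ : gfun r 0 = (fun z => z `^ r)); first exact: powRN_cvg0.
  by apply/funext => z; rewrite /gfun expr0 mulr1.
have cn : r * Gstat_add 1 A1 z - Gstat_add 0 A0 z + 1 @[z --> +oo] --> r * 0 - c * A0 + 1.
  apply: cvgD; last exact: cvg_cst.
  by apply: cvgB => //; apply: cvgM => //; exact: cvg_cst.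
have cA0 : c * A0 < 1.
  apply: (@le_lt_trans _ _ c); first by rewrite ler_piMr// divr_ge0.
  by rewrite ltr_pdivrMr// mul1r ltr_nat.
pose a := (1 - c * A0) / 2; have a0 : 0 < a by rewrite divr_gt0// subr_gt0.
rewrite /est jE /phi (negPf rN); apply/cvgryPge => B.
pose q := a / (r ^+ 2 * (`|B| + 1)).
have r20 : 0 < r ^+ 2 by rewrite exprn_even_gt0.
have B0 : 0 < `|B| + 1 by rewrite ltr_wpDl.
have q0 : 0 < q by rewrite divr_gt0// mulr_gt0.
near=> z.
have z1 : 1 < z by near: z; apply: nbhs_pinfty_gt; rewrite num_real.
have g0 : 0 < Gstat_add 1 A1 z by rewrite /Gstat_add A10 mulr0 addr0 mulr_gt0// gfun1_gt0.
have gq : Gstat_add 1 A1 z <= q by near: z; apply: (cvgr_le _ c1).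
have na : a <= r * Gstat_add 1 A1 z - Gstat_add 0 A0 z + 1.
  by near: z; apply: (cvgr_ge _ cn); rewrite mulr0 /a; lra.
rewrite ler_pdivlMr; last by rewrite mulr_gt0.
apply: le_trans na; apply: (@le_trans _ _ ((`|B| + 1) * (r ^+ 2 * q))).
  apply: (@le_trans _ _ ((`|B| + 1) * (r ^+ 2 * Gstat_add 1 A1 z))).
    apply: ler_wpM2r; first by apply: mulr_ge0; exact: ltW.
    by have := ler_norm B; lra.
  by rewrite !ler_pM2l.
by rewrite /q le_eqVlt; apply/orP; left; apply/eqP; field; rewrite rN gt_eqF.
Unshelve. all: by end_near. Qed.

End blowup.

(** * Measurability, and limits for a given sample *)

Section measurability.
Context d (T : measurableType d) (R : realType).
Implicit Types f : T -> R.

Lemma measurable_funV f : measurable_fun setT f -> measurable_fun setT (fun w => (f w)^-1).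
Proof.
(* The inverse as f / |f|^2, which reduces measurability to that of a power; both sides are 0 where
   f = 0. *)
move=> mf; rewrite (_ : (fun w => _) = (fun w => f w * (`|f w| `^ (-1)) ^+ 2)).
  apply: measurable_funM => //; apply: measurable_funX.
  apply: (measurableT_comp (measurable_powR (-1))).
  exact: (measurableT_comp (@normr_measurable R setT)).
apply/funext => w; have [->|f0] := eqVneq (f w) 0; first by rewrite invr0 mul0r.
rewrite powR_inv1// -normfV real_normK ?num_real//.
by rewrite expr2 mulrA mulfV// mul1r.
Qed.

Lemma measurable_fun_div (f g : T -> R) : measurable_fun setT f -> measurable_fun setT g ->
  measurable_fun setT (fun w => f w / g w).
Proof. by move=> mf mg; apply: measurable_funM => //; exact: measurable_funV. Qed.

Lemma measurable_gfun (r : R) u f : measurable_fun setT f ->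
  measurable_fun setT (fun w => gfun r u (f w)).
Proof.
move=> mf; apply: measurable_funM; first exact: (measurableT_comp (measurable_powR r)).
by apply: measurable_funX; exact: (measurableT_comp (@measurable_ln R)).
Qed.

Lemma measurable_phi l (r : R) (f0 f1 f2 : T -> R) :
  measurable_fun setT f0 -> measurable_fun setT f1 -> measurable_fun setT f2 ->
  measurable_fun setT (fun w => phi l r (f0 w) (f1 w) (f2 w)).
Proof.
move=> m0 m1 m2; rewrite /phi.
have mc (a : R) : measurable_fun setT (fun _ : T => a) by exact: measurable_cst.
have m3 : measurable_fun setT (fun w =>
    if r == 0 then f2 w / (2 * f1 w) else (r * f1 w - f0 w + 1) / (r ^+ 2 * f1 w)).
  case: (r == 0).
    exact: (measurable_fun_div m2 (measurable_funM (mc 2) m1)).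
  apply: (measurable_fun_div _ (measurable_funM (mc (r ^+ 2)) m1)).
  exact: (measurable_funD (measurable_funB (measurable_funM (mc r) m1) m0) (mc 1)).
case: l => [|[|[|l]]] //.
- case: (r == 0) => //.
  exact: (measurable_fun_div (measurable_funB m0 (mc 1)) (measurable_funM (mc r) m0)).
- apply: (measurable_fun_div (measurable_funM (mc 2) m1)).
  apply: (measurable_funD (measurable_funD (measurable_funM (mc (2 * r)) m1) (mc 1))).
  apply: (measurableT_comp (continuous_measurable_fun (@sqrt_continuous R))).
  exact: (measurable_funD (measurable_funM (mc (4 * r)) m1) (mc 1)).
Qed.

Variable Z : nat -> T -> R.
Hypothesis mZ : forall i, measurable_fun setT (Z i).
Variable N : nat.
Let zs w := [seq Z i w | i <- iota 0 N].

Let size_zs w : size (zs w) = N. Proof. by rewrite size_map size_iota. Qed.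

Lemma measurable_ostat k : (k < N)%N ->
  measurable_fun setT (fun w => ostat (zs w) (N - k)).
Proof.
move=> kN; apply: (measurability (@RGenOInfty.G R)) => [|/= _ [_] [x] -> <-].
  exact: RGenOInfty.measurableE.
apply: measurableI => //.
have sumE w : (exceed x (zs w))%:R = \sum_(0 <= i < N) \1_[set w | x < Z i w] w :> R.
  rewrite /exceed /zs count_map -sum1_count big_mkcond natr_sum /index_iota subn0.
  apply: eq_bigr => i _; rewrite indicE /=; case: ifPn => xi.
    by rewrite mem_set.
  by rewrite memNset//=; exact/negP.
have -> : (fun w => ostat (zs w) (N - k)) @^-1` `]x, +oo[ =
    [set w | k.+1%:R <= \sum_(0 <= i < N) \1_[set w | x < Z i w] w :> R].
  apply/seteqP; split => w /=; rewrite in_itv/= andbT -sumE ler_nat.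
    by apply: contraTT; rewrite -leqNgt -leNgt => /(@ostat_le _ k); rewrite size_zs; exact.
  by move=> /(@ostat_gt _ k); rewrite size_zs; exact.
apply: measurable_ge; apply: measurable_sum => i; apply: measurable_indic.
rewrite -[X in measurable X]setTI.
have -> : [set w | x < Z i w] = Z i @^-1` `]x, +oo[.
  by apply/seteqP; split=> w /=; rewrite in_itv/= andbT.
by apply: mZ => //; exact: measurable_itv.
Qed.

Lemma measurable_Gstat k (r : R) u : (k < N)%N ->
  measurable_fun setT (fun w => Gstat k r u (zs w)).
Proof.
move=> kN; rewrite /Gstat; apply: measurable_funM; first exact: measurable_cst.
under eq_fun do rewrite big_mkord.
apply: measurable_sum => i; apply: measurable_gfun.
under eq_fun do rewrite size_zs.
apply: measurable_fun_div; apply: measurable_ostat => //.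
exact: ltn_trans kN.
Qed.

Lemma measurable_gamma_hat l k (r : R) : (k < N)%N ->
  measurable_fun setT (fun w => gamma_hat l k r (zs w)).
Proof.
move=> kN; under eq_fun do rewrite gamma_hatE.
by apply: measurable_phi; exact: measurable_Gstat.
Qed.

End measurability.

(** * The effect of a new maximum on the statistics G *)

Section added_point.
Variables (R : realType) (s : seq R) (k : nat) (r : R).
Hypothesis ks : (0 < k < size s)%N.
Let Y := ostat s (size s - k).
Let A u := Gstat k r u s.

Lemma sort_cat_max x : (forall y, y \in s -> y <= x) ->
  sort <=%R (s ++ [:: x]) = rcons (sort <=%R s) x.
Proof.
move=> sx; apply: (@sorted_eq _ <=%R); rewrite ?sort_le_sorted//.
- exact: le_trans.
- exact: le_anti.
- have := sort_le_sorted s; have : forall y, y \in sort <=%R s -> y <= x.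
    by move=> y; rewrite mem_sort; exact: sx.
  case: (sort <=%R s) => //= y t yx; rewrite rcons_path => ->/=.
  by apply: yx; rewrite mem_last.
- by rewrite perm_sort cats1 perm_rcons perm_sym perm_rcons perm_cons perm_sort.
Qed.

(** The sample size and k both grow by one, so the threshold remains Y, and the top k + 1 values are
    x and the former top k. *)
Lemma Gstat_cat_max u x : (forall y, y \in s -> y <= x) ->
  Gstat k.+1 r u (s ++ [:: x]) = Gstat_add k r u (A u) (x / Y).
Proof.
move=> sx; have /andP[k0 km] := ks.
rewrite /Gstat /Gstat_add; congr (_ * _).
have oS i : (0 < i <= size s)%N -> ostat (s ++ [:: x]) i = ostat s i.
  move=> /andP[i0 i1]; rewrite /ostat sort_cat_max// nth_rcons size_sort.
  by case: i i0 i1 => // i _ ->.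
have oM : ostat (s ++ [:: x]) (size s).+1 = x.
  by rewrite /ostat sort_cat_max// nth_rcons size_sort/= ltnn eqxx.
rewrite size_cat/= addn1 subSS big_nat_recl//= subn0 oM oS; last first.
  by rewrite subn_gt0 km leq_subr.
congr (_ + _); rewrite /A /Gstat mulrA mulfV ?mul1r ?pnatr_eq0 -?lt0n//.
apply: eq_big_nat => i /andP[_ ik]; rewrite subSS oS//.
by rewrite subn_gt0 (ltn_trans ik km) leq_subr.
Qed.

Hypothesis Y0 : 0 < Y.

Let ratio_ge1 y : y \in top k s -> 1 <= y / Y.
Proof. by have /andP[_ km] := ks; move=> /(top_ge km) h; rewrite ler_pdivlMr// mul1r. Qed.

Lemma Gstat_ge0 u : 0 <= A u.
Proof.
have /andP[_ km] := ks; rewrite /A GstatE ?(ltnW km)// mulr_ge0// big_seq.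
apply: sumr_ge0 => y /ratio_ge1 y1; rewrite mulr_ge0 ?powR_ge0// exprn_ge0//.
exact: ln_ge0.
Qed.

Lemma Gstat0_gt0 : 0 < A 0.
Proof.
have /andP[k0 km] := ks; rewrite /A GstatE ?(ltnW km)// mulr_gt0 ?invr_gt0 ?ltr0n//.
have : (0 < size (top k s))%N by rewrite size_top// ltnW.
move: ratio_ge1; rewrite -/Y; case: (top k s) => // y t h _.
rewrite big_cons ltr_pwDl//.
  by rewrite /gfun expr0 mulr1 powR_gt0// (lt_le_trans ltr01)// h// mem_head.
by apply: sumr_ge0 => z _; rewrite /gfun expr0 mulr1 powR_ge0.
Qed.

Lemma Gstat0_le1 : r < 0 -> A 0 <= 1.
Proof.
move=> r0; have /andP[k0 km] := ks; rewrite /A GstatE ?(ltnW km)//.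
rewrite ler_pdivrMl ?ltr0n// mulr1 -[leRHS](_ : \sum_(y <- top k s) 1 = k%:R); last first.
  by rewrite big_const_seq count_predT size_top ?(ltnW km)// iter_addr_0.
rewrite !big_seq; apply: ler_sum => y /ratio_ge1 y1.
rewrite /gfun expr0 mulr1 -[leRHS](powRr0 (y / Y)) ler_powR//.
exact: ltW.
Qed.

End added_point.

(** * The limit in x for a fixed sample *)

Section limit_added_point.
Variables (R : realType) (s : seq R) (k : nat) (r : R) (j : nat).
Hypothesis s_ge0 : forall y, y \in s -> 0 <= y.
Hypothesis ks : (0 < k < size s)%N.
Hypothesis j3 : (0 < j <= 3)%N.
Let Y := ostat s (size s - k).
Let A u := Gstat k r u s.
Let c : R := k%:R / k.+1%:R.
Let dif x := gamma_hat j k.+1 r (s ++ [:: x]) - gamma_hat j k r s.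
Let est z := phi j r (Gstat_add k r 0 (A 0) z) (Gstat_add k r 1 (A 1) z) (Gstat_add k r 2 (A 2) z).

Lemma dif_near : \forall x \near +oo, est (x / Y) - gamma_hat j k r s = dif x.
Proof.
have [M HM] : exists M, forall y, y \in s -> y <= M.
  elim: s => [|a t [M IH]]; first by exists 0.
  exists (Num.max a M) => y; rewrite inE => /orP[/eqP ->|/IH h].
    by rewrite le_max lexx.
  by rewrite le_max h orbT.
near=> x; have Mx : M <= x by near: x; apply: nbhs_pinfty_ge; rewrite num_real.
have sx y : y \in s -> y <= x by move=> /HM/le_trans; apply.
by rewrite /dif; congr (_ - _); rewrite gamma_hatE !Gstat_cat_max.
Unshelve. all: by end_near. Qed.

Lemma ratio_cvgy : 0 < Y -> x / Y @[x --> +oo] --> (+oo : set_system R).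
Proof.
by move=> Y0; apply: (@gt0_cvgMly _ _ _ Y^-1 id); [rewrite invr_gt0|exact: cvg_id].
Qed.

Lemma dif_cvg_fin (l : R) : 0 < Y -> est z @[z --> +oo] --> l ->
  (dif x)%:E @[x --> +oo] --> (l - gamma_hat j k r s)%:E.
Proof.
move=> Y0 el.
have H : est (x / Y) - gamma_hat j k r s @[x --> +oo] --> l - gamma_hat j k r s.
  apply: cvgB; last exact: cvg_cst.
  exact: (cvg_comp _ _ (ratio_cvgy Y0) el).
have H2 : dif x @[x --> +oo] --> l - gamma_hat j k r s.
  apply: cvg_trans H; apply: near_eq_cvg; exact: dif_near.
by apply/fine_cvgP; split; [near=> x | exact: H2].
Unshelve. all: by end_near. Qed.

Lemma dif_cvgy : 0 < Y -> est z @[z --> +oo] --> (+oo : set_system R) ->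
  (dif x)%:E @[x --> +oo] --> +oo%E.
Proof.
move=> Y0 el; apply/cvgeryP/cvgryPge => B.
have /cvgryPge/(_ (B + gamma_hat j k r s)) := cvg_comp _ _ (ratio_cvgy Y0) el.
by apply: filterS2 dif_near => x <- /=; rewrite lerBrDr.
Qed.

Lemma dif_cvgNy : 0 < Y -> est z @[z --> +oo] --> (-oo : set_system R) ->
  (dif x)%:E @[x --> +oo] --> -oo%E.
Proof.
move=> Y0 el; apply/cvgerNyP/cvgrNyPle => B.
have /cvgrNyPle/(_ (B + gamma_hat j k r s)) := cvg_comp _ _ (ratio_cvgy Y0) el.
by apply: filterS2 dif_near => x <- /=; rewrite lerBlDr.
Qed.

Lemma dif_cvg_r0 : r = 0 -> 0 < Y -> (dif x)%:E @[x --> +oo] --> +oo%E.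
Proof.
move=> r0 Y0; apply: dif_cvgy => //; apply: est_r0 => //; exact: Gstat_ge0.
Qed.

Lemma dif_cvg_rpos : 0 < r -> 0 < Y ->
  (dif x)%:E @[x --> +oo] --> (r^-1 - gamma_hat j k r s)%:E.
Proof.
move=> r0 Y0; apply: dif_cvg_fin => //; apply: est_rpos => //.
  exact: Gstat0_gt0.
exact: Gstat_ge0.
Qed.

Lemma dif_cvg_rneg : r < 0 -> 0 < Y ->
  (j = 2 -> phi2_den r (c * A 1) != 0) -> (j = 3 -> c * A 1 != 0) ->
  (dif x)%:E @[x --> +oo] -->
    (phi j r (c * A 0) (c * A 1) (c * A 2) - phi j r (A 0) (A 1) (A 2))%:E.
Proof.
move=> r0 Y0 h2 h3; rewrite /A -gamma_hatE; apply: dif_cvg_fin => //.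
by apply: est_rneg => //; [exact: Gstat0_gt0 | case/andP: ks].
Qed.

(** Existence at every sample, degenerate ones included, is what makes [Bn] measurable as a
    pointwise limit. *)
Lemma is_cvg_dif : exists l : \bar R, (dif x)%:E @[x --> +oo] --> l.
Proof.
have Y_ge0 : 0 <= Y by exact: ostat_ge0.
have /andP[k0 km] := ks.
have c0 : 0 < c by rewrite divr_gt0 ?ltr0n.
have [Y0|] := ltP 0 Y; last first.
  (* Division by the zero threshold gives x / Y = 0, so the difference is constant for large x. *)
  move=> Yle; have Y0 : Y = 0 by apply/eqP; rewrite eq_le Yle.
  exists (est 0 - gamma_hat j k r s)%:E.
  have H : (fun _ : R => (est 0 - gamma_hat j k r s)%:E) x @[x --> +oo] -->
    (est 0 - gamma_hat j k r s)%:E by exact: cvg_cst.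
  apply: cvg_trans H; apply: near_eq_cvg.
  by apply: filterS dif_near => x <-; rewrite Y0 invr0 mulr0.
have A00 : 0 < A 0 by exact: Gstat0_gt0.
have A10 : 0 <= A 1 by exact: Gstat_ge0.
have A20 : 0 <= A 2 by exact: Gstat_ge0.
have [r0|r0|r0] := ltgtP r 0; last 2 first.
- by exists (r^-1 - gamma_hat j k r s)%:E; exact: dif_cvg_rpos.
- by exists +oo%E; exact: dif_cvg_r0.
have [[j2 d0]|h2] := pselect (j = 2 /\ phi2_den r (c * A 1) = 0).
  by exists -oo%E; apply: dif_cvgNy => //; exact: est_rneg_den0.
have [[jj a10]|h3] := pselect (j = 3 /\ A 1 = 0).
  by exists +oo%E; apply: dif_cvgy => //; apply: est_rneg_A1_0 => //; exact: Gstat0_le1.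
exists (phi j r (c * A 0) (c * A 1) (c * A 2) - phi j r (A 0) (A 1) (A 2))%:E.
apply: dif_cvg_rneg => //.
  by move=> j2; apply/eqP => d0; apply: h2.
move=> jj; rewrite mulf_neq0//; first by rewrite gt_eqF.
by apply/eqP => d0; apply: h3.
Qed.

End limit_added_point.

(** * The limit in probability *)

Section breakdown.
Context d (T : measurableType d) (R : realType) (P : probability T R).
Variable X : nat -> {RV P >-> R}.
Hypothesis X_indep : mutually_independent X.
Hypothesis X_id : identically_distributed X.
Hypothesis X_ge0 : forall i w, 0 <= X i w.
Variable gamma : R.
Hypothesis gamma0 : 0 < gamma.
Hypothesis RV : forall x : R, 0 < x ->
  (fun t => quantile_U (X 0%N) (t * x) / quantile_U (X 0%N) t) @ +oo --> x `^ gamma.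
Variable r : R.
Hypothesis gr : gamma * r < 1.
Variable k : nat -> nat.
Hypothesis k_oo : (k n)%:R @[n --> \oo] --> (+oo : set_system R).
Hypothesis nk_oo : n%:R / (k n)%:R @[n --> \oo] --> (+oo : set_system R).
Variable j : nat.
Hypothesis j3 : (0 < j <= 3)%N.

Let m n := n.-1.
Let k' n := (k n).-1.
Let smp (x : nat * T) := sample X (m x.1) x.2.
Let Y (x : nat * T) := ostat (smp x) (size (smp x) - k' x.1).

Let k2 : \forall n \near \oo, (2 <= k n)%N.
Proof.
have /cvgryPge/(_ 2) := k_oo; apply: filterS => n.
by rewrite ler_nat.
Qed.

Let k'_oo : (k' n)%:R @[n --> \oo] --> (+oo : set_system R).
Proof.
apply/cvgryPge => B; have /cvgryPge/(_ (B + 1)) := k_oo.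
apply: filterS2 k2 => n kn h; rewrite -(lerD2r 1) (le_trans h)// natr1 ler_nat /k'.
by rewrite prednK// ltnW.
Qed.

Let mk_oo : (m n)%:R / (k' n)%:R @[n --> \oo] --> (+oo : set_system R).
Proof.
(* The factor 2 compensates for n - 1 >= n / 2. *)
apply/cvgryPge => B; have /cvgryPge/(_ (2 * `|B|)) := nk_oo.
apply: filterS3 k2 (nbhs_infty_ge 2) => n kn n2.
have k0 : 0 < (k n)%:R :> R by rewrite ltr0n ltnW.
have k'0 : 0 < (k' n)%:R :> R by rewrite ltr0n /k' -subn1 subn_gt0.
have mE : (m n)%:R = n%:R - 1 :> R by rewrite /m -subn1 natrB// ltnW.
have kE : (k' n)%:R = (k n)%:R - 1 :> R by rewrite /k' -subn1 natrB// ltnW.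
have n2R : 2 <= n%:R :> R by rewrite ler_nat.
rewrite !ler_pdivlMr// mE kE => h.
have B0 := ler_norm B; have nB := normr_ge0 B.
have h1 : B * ((k n)%:R - 1) <= `|B| * ((k n)%:R - 1).
  by apply: ler_wpM2r => //; rewrite -kE ltW.
apply: (le_trans h1); nra.
Qed.

Let kS n : (2 <= k n)%N -> k n = (k' n).+1.
Proof. by move=> k2n; rewrite /k' prednK// ltnW. Qed.

Let kns : \forall n \near \oo, (2 <= k n)%N /\ (0 < k' n < m n)%N.
Proof.
by near=> n; split; near: n; [exact: k2 | exact: (k_lt_m k'_oo mk_oo)].
Unshelve. all: by end_near. Qed.

Let size_smp x : size (smp x) = m x.1.
Proof. by rewrite size_map size_iota. Qed.

Let smp_ge0 x y : y \in smp x -> 0 <= y.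
Proof. by move=> /mapP[i _ ->]. Qed.

Let dif (x : nat * T) z := gamma_hat j (k x.1) r (smp x ++ [:: z])
  - gamma_hat j (k' x.1) r (smp x).

Lemma Bn_lim n w (l : \bar R) : (dif (n, w) z)%:E @[z --> +oo] --> l ->
  Bn X j n (k n) r w = l.
Proof. by move=> h; apply: cvg_lim. Qed.

Lemma Bn_cvg n w : (2 <= k n)%N -> (0 < k' n < m n)%N ->
  (dif (n, w) z)%:E @[z --> +oo] --> Bn X j n (k n) r w.
Proof.
move=> k2n km.
have ks : (0 < k' n < size (smp (n, w)))%N by rewrite size_smp.
have [l hl] := is_cvg_dif r (@smp_ge0 (n, w)) ks j3.
have {}hl : (dif (n, w) z)%:E @[z --> +oo] --> l by rewrite /dif /= kS.
by rewrite (Bn_lim hl).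
Qed.

(** As the limit over real x exists at every sample point, it is also the limit along the integers,
    hence of a sequence of measurable functions. *)
Lemma measurable_Bn n : (2 <= k n)%N -> (0 < k' n < m n)%N ->
  measurable_fun setT (Bn X j n (k n) r).
Proof.
move=> k2n km.
apply: (@emeasurable_fun_cvg _ _ _ setT (fun N w => (dif (n, w) N%:R)%:E)); last first.
  move=> w _; have H := @Bn_cvg n w k2n km.
  exact: (cvg_comp _ _ (@cvgr_idn R) H).
move=> N; apply/measurable_EFinP; apply: measurable_funB.
  (* The added point is treated as one more, constant, random variable. *)
  pose Z i (w : T) := if (i < m n)%N then X i w else N%:R.
  have mZ i : measurable_fun setT (Z i).
    by rewrite /Z; case: (i < m n)%N; [exact: measurable_funP | exact: measurable_cst].
  have kn : (k n < (m n).+1)%N by rewrite kS// ltnS; case/andP: km.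
  rewrite [X in measurable_fun _ X](_ : _ = (fun w =>
    gamma_hat j (k n) r [seq Z i w | i <- iota 0 (m n).+1])).
    exact: (measurable_gamma_hat mZ j r kn).
  apply/funext => w; congr gamma_hat; rewrite -[(m n).+1]addn1 iotaD map_cat /= add0n.
  congr (_ ++ _); last by rewrite /Z ltnn.
  by apply/eq_in_map => i; rewrite mem_iota /Z add0n => /andP[_ ->].
have mX i : measurable_fun setT (X i) by exact: measurable_funP.
have /andP[_ k'm] := km.
exact: (measurable_gamma_hat mX j r k'm).
Qed.

Let Ypos : \forall x \near whp P, 0 < Y x.
Proof. exact: (ostat_gt0_near X_indep X_id X_ge0 gamma0 RV k'_oo mk_oo). Qed.

Let G0 : Gstat (k' x.1) r 0 (smp x) @[x --> whp P] --> (1 - gamma * r)^-1.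
Proof. exact: (Gstat0_cvg X_indep X_id X_ge0 gamma0 RV k'_oo mk_oo gr). Qed.

Let G1 : Gstat (k' x.1) r 1 (smp x) @[x --> whp P] --> gamma / (1 - gamma * r) ^+ 2.
Proof. exact: (Gstat1_cvg X_indep X_id X_ge0 gamma0 RV k'_oo mk_oo gr). Qed.

Lemma Bn_r0 : r = 0 -> \forall x \near whp P, Bn X j x.1 (k x.1) r x.2 = +oo%E.
Proof.
move=> r0; apply: filterS2 (whp_near P kns) Ypos => -[n w] /= [k2n km] Y0.
have ks : (0 < k' n < size (smp (n, w)))%N by rewrite size_smp.
by apply: Bn_lim; rewrite /dif /= kS//; exact: (dif_cvg_r0 ks j3 r0 Y0).
Qed.

Let D0 : 0 < 1 - gamma * r. Proof. by rewrite subr_gt0. Qed.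
Let a0 := (1 - gamma * r)^-1.
Let a1 := gamma / (1 - gamma * r) ^+ 2.
Let a0_gt0 : 0 < a0. Proof. by rewrite invr_gt0. Qed.
Let a1_gt0 : 0 < a1. Proof. by rewrite divr_gt0// exprn_gt0. Qed.

(** At the limit of G(k, r, 1) the discriminant of the second estimator is a perfect square. *)
Let discrE : 4 * r * a1 + 1 = ((1 + gamma * r) / (1 - gamma * r)) ^+ 2.
Proof. by rewrite /a1; field; rewrite gt_eqF. Qed.

Let phi2_den_lim_gt0 : 0 < phi2_den r a1.
Proof. by apply: phi2_den_gt0; rewrite discrE sqr_ge0. Qed.

Let phi_lim (u0 u1 u2 : nat * T -> R) : r != 0 ->
  u0 x @[x --> whp P] --> a0 -> u1 x @[x --> whp P] --> a1 ->
  phi j r (u0 x) (u1 x) (u2 x) @[x --> whp P] --> phi j r a0 a1 0.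
Proof.
move=> r0 h0 h1; have H : phi j r (u0 x) (u1 x) 0 @[x --> whp P] --> phi j r a0 a1 0.
  by apply: (@phi_cvg _ _ _ _ j r u0 u1 (fun=> 0) a0 a1 0) => //; rewrite ?gt_eqF//; exact: cvg_cst.
by rewrite (_ : (fun x => _) = (fun x => phi j r (u0 x) (u1 x) 0))// /phi (negPf r0).
Qed.

(** Consistency of the estimators. Positivity of r gives 1 + gamma r > 0, which fixes the sign of
    the square root. *)
Let phi_consistent : 0 < r -> phi j r a0 a1 0 = gamma.
Proof.
move=> r0; have rN : r != 0 by rewrite gt_eqF.
have DN : 1 - gamma * r != 0 by rewrite gt_eqF.
rewrite /phi (negPf rN); case: j j3 => [|[|[|[|]]]] // _.
- by rewrite /a0; field; rewrite rN DN.
- have pos : 0 < 1 + gamma * r by rewrite addr_gt0// mulr_gt0.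
  rewrite /phi2_den discrE sqrtr_sqr ger0_norm; last by rewrite divr_ge0 ?ltW.
  rewrite /a1; have -> : 2 * r * (gamma / (1 - gamma * r) ^+ 2) + 1 +
     (1 + gamma * r) / (1 - gamma * r) = 2 / (1 - gamma * r) ^+ 2 by field.
  by field.
- by rewrite /a0 /a1; field; rewrite rN DN gt_eqF.
Qed.

Lemma Bn_rpos : 0 < r -> exists v : nat * T -> R,
  (\forall x \near whp P, Bn X j x.1 (k x.1) r x.2 = (v x)%:E) /\
  v x @[x --> whp P] --> (1 - gamma * r) / r.
Proof.
move=> r0; have rN : r != 0 by rewrite gt_eqF.
exists (fun x => r^-1 - gamma_hat j (k' x.1) r (smp x)); split.
  apply: filterS2 (whp_near P kns) Ypos => -[n w] /= [k2n km] Y0.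
  have ks : (0 < k' n < size (smp (n, w)))%N by rewrite size_smp.
  by apply: Bn_lim; rewrite /dif /= kS//; exact: (dif_cvg_rpos ks j3 r0 Y0).
have -> : (1 - gamma * r) / r = r^-1 - gamma by field.
apply: cvgB; first exact: cvg_cst.
rewrite -(phi_consistent r0); under eq_fun do rewrite gamma_hatE.
exact: phi_lim.
Qed.

(** Since c = k' / (k' + 1) tends to 1, both terms of the difference tend to the same value
    [phi j r a0 a1 0] and cancel, whatever this value is. *)
Lemma Bn_rneg : r < 0 -> exists v : nat * T -> R,
  (\forall x \near whp P, Bn X j x.1 (k x.1) r x.2 = (v x)%:E) /\
  v x @[x --> whp P] --> (0 : R).
Proof.
move=> r0; have rN : r != 0 by rewrite lt_eqF.
pose c (x : nat * T) : R := (k' x.1)%:R / (k' x.1).+1%:R.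
have c1 : c x @[x --> whp P] --> (1 : R).
  apply: (@cvg_whp_fst _ _ _ P (fun n => (k' n)%:R / (k' n).+1%:R : R)).
  have H : 1 - (k' n).+1%:R^-1 @[n --> \oo] --> (1 : R).
    rewrite -[X in _ --> X]subr0; apply: cvgB; first exact: cvg_cst.
    apply/gtr0_cvgV0; first by near=> n; rewrite ltr0n.
    apply: (ger_cvgy _ k'_oo); near=> n; by rewrite ler_nat.
  rewrite (_ : (fun n => _) = (fun n => 1 - (k' n).+1%:R^-1))//.
  apply/funext => n; rewrite -natr1; field.
  by rewrite natr1 pnatr_eq0.
have cG (u : nat * T -> R) (a : R) : u x @[x --> whp P] --> a -> c x * u x @[x --> whp P] --> a.
  by move=> h; rewrite -[X in _ --> X]mul1r; apply: cvgM.
pose A u (x : nat * T) := Gstat (k' x.1) r u (smp x).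
exists (fun x => phi j r (c x * A 0 x) (c x * A 1 x) (c x * A 2 x)
               - phi j r (A 0 x) (A 1 x) (A 2 x)); split; last first.
  rewrite -[X in _ --> X](subrr (phi j r a0 a1 0)); apply: cvgB.
    by apply: (phi_lim (fun x => c x * A 2 x) rN); exact: cG.
  exact: (phi_lim (A 2) rN).
(* [E1] and [E2] exclude, with high probability, the samples at which a denominator vanishes and the
   limit in x may be infinite. *)
have E1 : \forall x \near whp P, 0 < c x * A 1 x.
  by apply: (cvgr_gt _ (cG _ _ G1)).
have E2 : \forall x \near whp P, 0 < phi2_den r (c x * A 1 x).
  have H : phi2_den r (c x * A 1 x) @[x --> whp P] --> phi2_den r a1.
    rewrite /phi2_den; apply: cvgD.
      apply: cvgD; last exact: cvg_cst.
      by apply: cvgM; [exact: cvg_cst | exact: cG].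
    apply: (continuous_cvg _ (@sqrt_continuous R _)).
    apply: cvgD; last exact: cvg_cst.
    by apply: cvgM; [exact: cvg_cst | exact: cG].
  by apply: (cvgr_gt _ H).
apply: filterS2 (filterI (whp_near P kns) Ypos) (filterI E1 E2).
move=> [n w] /= [[k2n km] Y0] [p1 p2].
have ks : (0 < k' n < size (smp (n, w)))%N by rewrite size_smp.
apply: Bn_lim; rewrite /dif /= kS//.
apply: (dif_cvg_rneg ks j3 r0 Y0) => _.
  by rewrite gt_eqF.
by rewrite gt_eqF.
Unshelve. all: by end_near. Qed.

Lemma cvg_in_prob_fin (v : nat * T -> R) (l : R) :
  (\forall x \near whp P, Bn X j x.1 (k x.1) r x.2 = (v x)%:E) ->
  v x @[x --> whp P] --> l ->
  cvg_in_prob P (fun n => Bn X j n (k n) r) l%:E.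
Proof.
move=> Bv vl eps eps0; apply: whp_prob0.
  apply: filterS kns => n [k2n km]; rewrite -[X in measurable X]setTI.
  have mB : measurable_fun setT (fun w => `|Bn X j n (k n) r w - l%:E|%E).
    apply: (measurableT_comp (@abse_measurable R setT)).
    by apply: emeasurable_funB => //; exact: measurable_Bn.
  exact: emeasurable_fun_c_infty.
have /cvgrPdist_lt/(_ _ eps0) := vl.
apply: filterS2 Bv => x Bx h /=; apply/negP; rewrite Bx -ltNge.
by rewrite -EFinB lte_fin distrC.
Qed.

Lemma cvg_in_prob_pinfty :
  (\forall x \near whp P, Bn X j x.1 (k x.1) r x.2 = +oo%E) ->
  cvg_in_prob P (fun n => Bn X j n (k n) r) +oo%E.
Proof.
move=> By M; apply: whp_prob0.
  apply: filterS kns => n [k2n km]; rewrite -[X in measurable X]setTI.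
  by apply: emeasurable_fun_infty_c => //; exact: measurable_Bn.
by apply: (@filterS _ _ (whp_filter P) _ _ _ By) => x Bx /=; rewrite Bx leye_eq.
Qed.

End breakdown.

Theorem theorem4 (d : measure_display) (T : measurableType d) (R : realType)
  (P : probability T R) (X : nat -> {RV P >-> R}) (gamma r : R)
  (k : nat -> nat) (j : nat) :
  0 < gamma ->
  mutually_independent X ->
  identically_distributed X ->
  (forall i w, 0 <= X i w) ->
  (forall x : R, 0 < x ->
     (fun t => quantile_U (X 0%N) (t * x) / quantile_U (X 0%N) t) @ +oo
       --> x `^ gamma) ->
  gamma * r < 1 ->
  (fun n => (k n)%:R : R) @ \oo --> +oo ->
  (fun n => n%:R / (k n)%:R : R) @ \oo --> +oo ->
  (0 < j <= 3)%N ->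
  cvg_in_prob P (fun n => Bn X j n (k n) r)
    (if r < 0 then (0:R)%:E else if r == 0 then +oo%E else ((1 - gamma * r) / r)%:E).
Proof.
move=> gamma0 X_indep X_id X_ge0 RV gr k_oo nk_oo j3.
have [r0|r0|r0] := ltgtP r 0.
- have [v [Bv v0]] := Bn_rneg X_indep X_id X_ge0 gamma0 RV gr k_oo nk_oo j3 r0.
  exact: (cvg_in_prob_fin X_ge0 k_oo nk_oo j3 Bv v0).
- have [v [Bv vl]] := Bn_rpos X_indep X_id X_ge0 gamma0 RV gr k_oo nk_oo j3 r0.
  exact: (cvg_in_prob_fin X_ge0 k_oo nk_oo j3 Bv vl).
- apply: (cvg_in_prob_pinfty X_ge0 k_oo nk_oo j3).
  exact: (Bn_r0 X_indep X_id X_ge0 gamma0 RV k_oo nk_oo j3 r0).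
Qed.
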